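(* Let $\Sigma$ be a closed hypersurface in $\mathbb{H}^{n+1}$, and let $\{a_{i,j}(x)\,|\,0 \leq i < j \leq n\}$ be non-negative functions on $\Sigma$ satisfying $\sum_{0 \leq i < j \leq n}a_{i,j}(x)=1$. Let $k=\max\{j\,|\,a_{i,j}>0 \text{ (at some point of } \Sigma)\text{ for some } 0 \leq i < j \leq n\}$, and suppose $\tilde{\kappa}\in\Gamma_{k}^+$ at every point of $\Sigma$. If there exists a constant $\beta > 0$ such that on $\Sigma$ $$\sum_{0 \leq i < j \leq k} a_{i,j}\left(\frac{H_{i}(\tilde{\kappa})}{H_{j}(\tilde{\kappa})}\right)^{\frac{1}{j-i}} = \beta \frac{u}{V-u},$$ where $u=\langle \sinh r\,\partial_{r}, \nu \rangle$ is the support function, then $\Sigma$ is a geodesic sphere.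
   Context: $\mathbb{H}^{n+1}$ is hyperbolic space of constant sectional curvature $-1$, $n\ge1$ an integer. Fix a point $o\in\mathbb{H}^{n+1}$, let $r$ be the hyperbolic distance to $o$, and put $V=\cosh r$ (note $V-u>0$). A closed hypersurface $\Sigma$ is smooth, compact, connected, without boundary; $\nu$ is its unit outward normal (if $\Sigma$ is embedded, pointing out of the bounded domain enclosed by $\Sigma$; in general, the global unit normal equal to $\partial_r$ at a point of $\Sigma$ where $r$ is maximal). The second fundamental form is $h(X,Y)=\langle\bar\nabla_X\nu,Y\rangle$, where $\bar\nabla$ is the Levi-Civita connection of $\mathbb{H}^{n+1}$; its eigenvalues with respect to the induced metric are the principal curvatures $\kappa=(\kappa_1,\dots,\kappa_n)$, and $\tilde\kappa=(\kappa_1-1,\dots,\kappa_n-1)$ are the shifted principal curvatures. For $\lambda\in\mathbb{R}^n$, $H_k(\lambda)=\sigma_k(\lambda)/\binom{n}{k}$, where $\sigma_k$ is the $k$th elementary symmetric function, and $H_0=1$. $\Gamma_k^+=\{\lambda\in\mathbb{R}^n:\sigma_i(\lambda)>0,\ 1\le i\le k\}$. A geodesic sphere is the set of points at a fixed positive distance from some point. *)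

(* Defs.v *)
From HB Require Import structures.
From mathcomp Require Import all_boot all_order all_algebra.
From mathcomp Require Import all_classical all_reals all_analysis.

Set Implicit Arguments.
Unset Strict Implicit.
Unset Printing Implicit Defensive.

Import Order.TTheory GRing.Theory Num.Theory.
Import numFieldNormedType.Exports.

Local Open Scope classical_set_scope.
Local Open Scope ring_scope.

Section HyperbolicFunctions.
Context {R : realType}.
Implicit Types t : R.

Definition cosh t : R := (expR t + expR (- t)) / 2.
Definition sinh t : R := (expR t - expR (- t)) / 2.
Definition arcosh t : R := ln (t + Num.sqrt (t ^+ 2 - 1)).

End HyperbolicFunctions.

(** Hyperboloid model: the hyperbolic space of dimension [n.+1] is the upper
    sheet of [mink x x = -1] in the Minkowski space ['rV[R]_n.+2], with the
    Riemannian metric induced by [mink]; coordinate [0] is the timelike one. *)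
Section HyperbolicSpace.
Context {R : realType} {n : nat}.
Local Notation E := 'rV[R]_n.+2.
Implicit Types (x y o v w : E).

Definition mink v w : R :=
  - (v 0 0 * w 0 0) + \sum_(i < n.+1) v 0 (lift ord0 i) * w 0 (lift ord0 i).

Definition hyperbolic_space : set E :=
  [set x | mink x x = -1 /\ 0 < x 0 0].

Definition hdist x y : R := arcosh (- mink x y).

(** Orthogonal projection onto the tangent space [mink x v = 0] at [x]. *)
Definition tangent_proj x v : E := v + mink v x *: x.

(** The geodesic from [o] to [x] is [cosh t *: o + sinh t *: e] with [e] a unit
    tangent vector at [o]; its velocity at [t = r] is the vector below.  At
    [x = o], where the radial field is undefined, it evaluates to [0]. *)
Definition radial_field o x : E :=
  (sinh (hdist o x))^-1 *: (cosh (hdist o x) *: x - o).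

Definition geodesic_sphere (S : set E) : Prop :=
  exists c rho, [/\ hyperbolic_space c, 0 < rho &
    S = [set x | hyperbolic_space x /\ hdist c x = rho]].

End HyperbolicSpace.
Arguments hyperbolic_space : clear implicits.

(** C^infinity on an open set: every iterated directional derivative is
    (Frechet) differentiable at every point of [U]. *)
Definition smooth_on (R : realType) (m p : nat) (U : set 'rV[R]_m)
    (f : 'rV[R]_m -> 'rV[R]_p) : Prop :=
  forall (vs : seq 'rV[R]_m) (z : 'rV[R]_m), U z ->
    differentiable (foldr (fun v g => 'D_v g) f vs) z.

Section Manifolds.
Context {R : realType} {n : nat} {M : topologicalType}.

(** The values of [chart_map] outside [chart_dom], and of [chart_inv] outside
    the image of [chart_dom], are irrelevant. *)
Record chart := Chart {
  chart_dom : set M;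
  chart_map : M -> 'rV[R]_n;
  chart_inv : 'rV[R]_n -> M }.

Definition chart_codom (c : chart) : set 'rV[R]_n :=
  chart_map c @` chart_dom c.

Definition is_chart (c : chart) : Prop :=
  [/\ open (chart_dom c), open (chart_codom c),
      forall p, chart_dom c p -> chart_inv c (chart_map c p) = p,
      {within chart_dom c, continuous (chart_map c)} &
      {within chart_codom c, continuous (chart_inv c)}].

Definition smooth_atlas (A : set chart) : Prop :=
  [/\ forall c, A c -> is_chart c,
      forall p, exists2 c, A c & chart_dom c p &
      forall c d, A c -> A d ->
        smooth_on (chart_map c @` (chart_dom c `&` chart_dom d))
                  (chart_map d \o chart_inv c)].

Definition smooth_map (p : nat) (A : set chart) (f : M -> 'rV[R]_p) : Prop :=
  forall c, A c -> smooth_on (chart_codom c) (f \o chart_inv c).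

Definition immersion (p : nat) (A : set chart) (f : M -> 'rV[R]_p) : Prop :=
  smooth_map A f /\
  forall c z, A c -> chart_codom c z -> row_free (jacobian (f \o chart_inv c) z).

End Manifolds.
Arguments chart : clear implicits.

Section Hypersurfaces.
Context {R : realType} {n : nat} {M : topologicalType}.
Local Notation E := 'rV[R]_n.+2.
Implicit Types (A : set (chart R n M)) (c : chart R n M) (X N : M -> E).

Definition closed_hypersurface A X : Prop :=
  [/\ [/\ hausdorff_space M, compact [set: M] & connected [set: M]],
      smooth_atlas A,
      forall p, hyperbolic_space R n (X p) &
      immersion A X].

(** The normal field is tangent to the hyperbolic space and orthogonal to the
    hypersurface; a global choice is fixed by the last condition. *)
Definition outward_unit_normal (o : E) A X N : Prop :=
  [/\ smooth_map A N,
      forall p, mink (N p) (X p) = 0 /\ mink (N p) (N p) = 1,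
      forall c z v, A c -> chart_codom c z ->
        mink (N (chart_inv c z)) ('D_v (X \o chart_inv c) z) = 0 &
      exists p, (forall q, hdist o (X q) <= hdist o (X p)) /\
                N p = radial_field o (X p)].

Definition coord_vec (i : 'I_n) : 'rV[R]_n := delta_mx 0 i.

Definition first_form c X (z : 'rV[R]_n) : 'M[R]_n :=
  \matrix_(i, j) mink ('D_(coord_vec i) (X \o chart_inv c) z)
                      ('D_(coord_vec j) (X \o chart_inv c) z).

(** The Levi-Civita connection of the hyperboloid is the tangential part of the
    flat derivative of the ambient Minkowski space. *)
Definition covariant_derivative c X (Y : M -> E) (v z : 'rV[R]_n) : E :=
  tangent_proj (X (chart_inv c z)) ('D_v (Y \o chart_inv c) z).

Definition second_form c X N (z : 'rV[R]_n) : 'M[R]_n :=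
  \matrix_(i, j) mink (covariant_derivative c X N (coord_vec i) z)
                      ('D_(coord_vec j) (X \o chart_inv c) z).

(** [kappa p] lists, with multiplicity and in arbitrary order, the eigenvalues
    of the second fundamental form with respect to the first one at [p]. *)
Definition principal_curvatures A X N (kappa : M -> 'rV[R]_n) : Prop :=
  forall c z, A c -> chart_codom c z ->
    char_poly (second_form c X N z *m invmx (first_form c X z)) =
    \prod_(i < n) ('X - (kappa (chart_inv c z) 0 i)%:P).

Definition shifted (kappa : M -> 'rV[R]_n) (p : M) : 'rV[R]_n :=
  kappa p - const_mx 1.

Definition potential (o : E) X (p : M) : R := cosh (hdist o (X p)).

Definition support_function (o : E) X N (p : M) : R :=
  mink (sinh (hdist o (X p)) *: radial_field o (X p)) (N p).

End Hypersurfaces.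

Section SymmetricFunctions.
Context {R : realType} {n : nat}.
Implicit Types (k : nat) (l : 'rV[R]_n).

Definition sigma k l : R :=
  \sum_(I : {set 'I_n} | #|I| == k) \prod_(i in I) l 0 i.

Definition normalized_sigma k l : R := sigma k l / 'C(n, k)%:R.

Definition Garding_cone k : set 'rV[R]_n :=
  [set l | forall i, (1 <= i <= k)%N -> 0 < sigma i l].

End SymmetricFunctions.

(* Main.v *)
(** Write [V = - mink o X] and [u = - mink o N].  At a point of maximal distance
    to [o] every shifted curvature is at least [(V - u) / u], so each quotient on
    the left of the equation is at most [u / (V - u)] and hence [beta <= 1].  On
    the other hand [H_j <= H_i * H_1 ^ (j - i)] in the Garding cone, so the left
    side is at least [1 / H_1] everywhere.  Together these give
    [V - u <= u * H_1], which says that [V], whose Laplacian on the hypersurface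
    is [n V - u (kappa_1 + ... + kappa_n)], is superharmonic.  The strong minimum
    principle makes [V] constant, so the hypersurface lies on a sphere centred
    at [o], and it fills that sphere by a closest-point argument. *)

Require Import Defs.
From HB Require Import structures.
From mathcomp Require Import all_boot all_order all_algebra.
From mathcomp Require Import all_classical all_reals all_analysis.
From mathcomp Require Import ring lra zify.
Import Order.TTheory GRing.Theory Num.Theory.
Import numFieldNormedType.Exports.
Set Implicit Arguments.
Unset Strict Implicit.
Unset Printing Implicit Defensive.
Local Open Scope classical_set_scope.
Local Open Scope ring_scope.

(** * Elementary symmetric functions on the Garding cone *)

Section ElementarySymmetric.
Context {R : rcfType} {T : finType}.
Implicit Types (l : T -> R) (S : {set T}).

(** The comparison [H_j <= H_i * H_1 ^ (j - i)] is obtained from Chebyshev's sum inequality, whose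
    only requirement is a sign for symmetric functions of the variables with two of them deleted.
    The difficulty is thus to delete variables without losing nonnegativity, and no real-rootedness
    enters. The curvature bound at a farthest point rests on the normal being radial there:
    [o = V X - u N], so the second derivatives of [mink o X] are [u h - V g], which is nonnegative
    at a minimum of [mink o X]. Positivity of [u] on the whole hypersurface is extracted from the
    equation itself, since [1 / H_1 > 0] and [V - u > 0]. Because [X] takes values in a linear
    space, the Laplacian of [V] can be handled without a connection on the hypersurface: it is the
    metric trace of flat second derivatives, and the Christoffel terms are of first order, so they
    go into the drift of a general elliptic operator with continuous coefficients. *)

Definition elsym_gen l S : {poly R} := \prod_(i in S) (1 + l i *: 'X).
(** Taken as coefficients of the generating polynomial, so that recursions become product rules; the
    index set [S] is a parameter because variables are deleted one at a time. *)
Definition elsym l S (j : nat) : R := (elsym_gen l S)`_j.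

Lemma elsym_genD1 l S i : i \in S ->
  elsym_gen l S = (1 + l i *: 'X) * elsym_gen l (S :\ i).
Proof. by move=> iS; rewrite /elsym_gen (big_setD1 i). Qed.

Lemma elsym0 l S : elsym l S 0 = 1.
Proof.
rewrite /elsym /elsym_gen -horner_coef0 horner_prod big1 // => i _.
by rewrite !hornerE.
Qed.

Lemma elsymD1S l S i j : i \in S ->
  elsym l S j.+1 = elsym l (S :\ i) j.+1 + l i * elsym l (S :\ i) j.
Proof.
move=> iS; rewrite /elsym (elsym_genD1 _ iS) mulrDl mul1r coefD -scalerAl coefZ.
by rewrite coefXM.
Qed.

Lemma size_elsym_gen l S : (size (elsym_gen l S) <= #|S|.+1)%N.
Proof.
rewrite /elsym_gen; apply: leq_trans (size_prod_leq _ _) _.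
rewrite leq_subLR.
apply: (@leq_trans (\sum_(i in S) 2).+1).
  rewrite ltnS; apply: leq_sum => i _.
  apply: leq_trans (size_polyD _ _) _; rewrite geq_max size_poly1 /=.
  by apply: leq_trans (size_scale_leq _ _) _; rewrite size_polyX.
by rewrite sum_nat_const muln2 -addnn addnS.
Qed.

Lemma elsym_eq0 l S j : (#|S| < j)%N -> elsym l S j = 0.
Proof. by move=> h; rewrite /elsym nth_default // (leq_trans (size_elsym_gen _ _)). Qed.

(** Euler's identity for a homogeneous polynomial: compare the coefficients of ['X^m] in the
    derivative of the generating polynomial, taken termwise and by the Leibniz rule. *)
Lemma sum_elsymD1_mul l S m :
  \sum_(i in S) l i * elsym l (S :\ i) m = m.+1%:R * elsym l S m.+1.
Proof.
have -> : m.+1%:R * elsym l S m.+1 = ((elsym_gen l S)^`())`_m.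
  by rewrite coef_deriv mulr_natl.
have -> : (elsym_gen l S)^`() = \sum_(i in S) l i *: elsym_gen l (S :\ i).
  move: {2}#|S| (erefl #|S|) => s; elim: s S => [|s IH] S cS.
    have /eqP -> : S == finset.set0 by rewrite -cards_eq0 cS.
    by rewrite /elsym_gen !big_set0 derivC.
  have /card_gt0P [a aS] : (0 < #|S|)%N by rewrite cS.
  have cS' : #|S :\ a| = s by move: cS; rewrite (cardsD1 a) aS => -[].
  rewrite (elsym_genD1 _ aS) derivM IH // [RHS](big_setD1 a) //=; congr (_ + _).
    by rewrite derivD derivC add0r derivZ derivX -scalerAl mul1r.
  rewrite mulr_sumr; apply: eq_bigr => i; rewrite !inE => /andP[ia iS].
  rewrite -scalerAr; congr (_ *: _).
  by rewrite finset.setDDl finset.setUC -finset.setDDl -elsym_genD1 // !inE eq_sym ia.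
by rewrite coef_sum; apply: eq_bigr => i _; rewrite coefZ.
Qed.

Lemma sum_elsymD1 l S m :
  \sum_(i in S) elsym l (S :\ i) m = (#|S|%:R - m%:R) * elsym l S m.
Proof.
case: m => [|m].
  by rewrite subr0 elsym0 mulr1 (eq_bigr (fun=> 1)) ?sumr_const // => i _;
    rewrite elsym0.
rewrite mulrBl -sum_elsymD1_mul.
have -> : #|S|%:R * elsym l S m.+1 = \sum_(i in S) elsym l S m.+1.
  by rewrite sumr_const mulr_natl.
by rewrite -sumrB; apply: eq_bigr => i iS; rewrite (elsymD1S _ _ iS) addrK.
Qed.

Lemma elsym1 l S : elsym l S 1 = \sum_(i in S) l i.
Proof.
rewrite -[LHS]mul1r -(sum_elsymD1_mul l S 0).
by apply: eq_bigr => i _; rewrite elsym0 mulr1.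
Qed.

Lemma elsym_ge0 l S j : (forall i, i \in S -> 0 <= l i) -> 0 <= elsym l S j.
Proof.
move=> l0; rewrite /elsym /elsym_gen; move: j.
elim/big_rec: _ => [|i p iS IH] j; first by rewrite coef1; case: eqP.
rewrite mulrDl mul1r -scalerAl coefD coefZ coefXM addr_ge0 // mulr_ge0 ?l0 //.
by case: ifP.
Qed.

(** Each factor splits as [(1 + t 'X) + l i 'X]; expanding the product in the second summands leaves
    a power of [1 + t 'X], whose coefficients are binomial. *)
Lemma elsym_shift l S t j : elsym (fun i => l i + t) S j =
  \sum_(i < j.+1) elsym l S i * (t ^+ (j - i) *+ 'C(#|S| - i, j - i)).
Proof.
have gen s : #|S| = s -> elsym_gen (fun i => l i + t) S =
    \sum_(i < s.+1) elsym l S i *: ('X^i * (1 + t *: 'X) ^+ (s - i)).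
  elim: s S => [|s IH] S cS.
    have /eqP S0 : S == finset.set0 by rewrite -cards_eq0 cS.
    rewrite big_ord1 elsym0 scale1r mul1r expr0 /elsym_gen.
    by rewrite S0 big_set0.
  have /card_gt0P [a aS] : (0 < #|S|)%N by rewrite cS.
  have cS' : #|S :\ a| = s by move: cS; rewrite (cardsD1 a) aS => -[].
  rewrite (elsym_genD1 _ aS) (IH _ cS').
  rewrite [RHS]big_ord_recl /= elsym0 scale1r mul1r subn0.
  have -> : \sum_(i < s.+1) elsym l S (bump 0 i) *:
       ('X^(bump 0 i) * (1 + t *: 'X) ^+ (s.+1 - bump 0 i)) =
     \sum_(i < s.+1) elsym l (S :\ a) i.+1 *: ('X^(i.+1) * (1 + t *: 'X) ^+ (s - i))
     + (l a *: 'X) * \sum_(i < s.+1) elsym l (S :\ a) i *: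
       ('X^i * (1 + t *: 'X) ^+ (s - i)).
    rewrite mulr_sumr -big_split; apply: eq_bigr => i _ /=.
    rewrite /bump /= add1n subSS (elsymD1S _ _ aS) scalerDl exprS.
    by rewrite -!mul_polyC polyCM; congr (_ + _); ring.
  have tail : (1 + t *: 'X) * (\sum_(i < s.+1) elsym l (S :\ a) i *:
       ('X^i * (1 + t *: 'X) ^+ (s - i))) =
     (1 + t *: 'X) ^+ s.+1 + \sum_(i < s.+1) elsym l (S :\ a) i.+1 *:
       ('X^(i.+1) * (1 + t *: 'X) ^+ (s - i)).
    rewrite [in RHS]big_ord_recr /= (@elsym_eq0 _ _ s.+1) ?cS' // scale0r addr0.
    rewrite big_ord_recl /= elsym0 scale1r mul1r subn0 mulrDr -exprS; congr (_ + _).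
    rewrite mulr_sumr; apply: eq_bigr => i _; rewrite /bump /= add1n.
    rewrite -scalerAr; congr (_ *: _).
    by rewrite mulrCA -exprS -subSn // subSS.
  by rewrite addrA -tail scalerDl; ring.
rewrite [LHS]/elsym (gen _ erefl) coef_sum.
have coefE (i : nat) : (i <= #|S|)%N ->
    ('X^i * (1 + t *: 'X) ^+ (#|S| - i))`_j =
    if (i <= j)%N then t ^+ (j - i) *+ 'C(#|S| - i, j - i) else 0.
  move=> _; rewrite coefXnM ltnNge; case: leqP => //= ij.
  rewrite exprDn coef_sum.
  under eq_bigr => m _ do rewrite expr1n mul1r exprZn coefMn coefZ coefXn.
  case: (ltnP (j - i) (#|S| - i).+1) => h.
    rewrite (bigD1 (Ordinal h)) //= eqxx mulr1 big1 ?addr0 // => m nm.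
    suff /negPf -> : (j - i)%N != m by rewrite mulr0 mul0rn.
    by apply: contraNneq nm => e; apply/eqP/val_inj.
  rewrite bin_small // mulr0n big1 // => m _.
  have /negPf -> : (j - i)%N != m by rewrite gtn_eqF // (leq_trans _ h).
  by rewrite mulr0 mul0rn.
(* One sum runs over [i <= #|S|], the other over [i <= j]; in either case the surplus terms
   vanish. *)
pose F (i : nat) := elsym l S i * (t ^+ (j - i) *+ 'C(#|S| - i, j - i)).
transitivity (\sum_(i < #|S|.+1 | (i <= j)%N) F i).
  rewrite [RHS]big_mkcond; apply: eq_bigr => i _.
  rewrite coefZ coefE; last by rewrite -ltnS.
  by case: ifP => // _; rewrite mulr0.
case: (leqP #|S| j) => h.
  rewrite (eq_bigl xpredT) => [|i]; last by rewrite (leq_trans _ h) // -ltnS.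
  rewrite (big_ord_widen j.+1 F) // big_mkcond; apply: eq_bigr => i _.
  case: ifP => // /negbT; rewrite -leqNgt => si.
  by rewrite /F elsym_eq0 ?mul0r.
by rewrite [RHS](big_ord_widen #|S|.+1 F) // leqW.
Qed.

(** The term [i = 0] alone is [t ^+ j] times a binomial coefficient, positive since [j <= #|S|]; the
    other terms are nonnegative. *)
Lemma elsym_shift_ge l S t j : 0 <= t -> (j <= #|S|)%N ->
  (forall i, (i <= j)%N -> 0 <= elsym l S i) ->
  t ^+ j <= elsym (fun i => l i + t) S j.
Proof.
move=> t0 jS l0; rewrite elsym_shift big_ord_recl /= elsym0 mul1r !subn0.
apply: (@le_trans _ _ (t ^+ j *+ 'C(#|S|, j))).
  by rewrite -[X in X <= _]mulr1n ler_wpMn2l ?exprn_ge0 // bin_gt0.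
rewrite lerDl sumr_ge0 // => i _; rewrite mulr_ge0 ?mulrn_wge0 ?exprn_ge0 //.
by apply: l0; rewrite /bump /= add1n ltn_ord.
Qed.

Lemma elsym_shift_ge0 l S t k : 0 <= t ->
  (forall i, (i <= k)%N -> 0 <= elsym l S i) ->
  forall j, (j <= k)%N -> 0 <= elsym (fun i => l i + t) S j.
Proof.
move=> t0 l0 j jk; have [jS|Sj] := leqP j #|S|; last by rewrite elsym_eq0.
apply: le_trans (elsym_shift_ge t0 jS _); first by rewrite exprn_ge0.
by move=> i ij; apply: l0; exact: leq_trans jk.
Qed.

(** The shifted function is a polynomial in [t], negative at [0] and positive for large [t]. *)
Lemma elsym_shift_root l S j : (j <= #|S|)%N -> elsym l S j < 0 ->
  exists2 t, 0 < t & elsym (fun i => l i + t) S j = 0.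
Proof.
move=> jS neg.
pose p : {poly R} := \sum_(i < j.+1)
  (elsym l S i * ('C(#|S| - i, j - i))%:R) *: 'X^(j - i).
have pE t : p.[t] = elsym (fun i => l i + t) S j.
  rewrite elsym_shift /p horner_sum; apply: eq_bigr => i _.
  by rewrite hornerZ hornerXn -mulr_natl; ring.
have p0 : p.[0] < 0.
  rewrite pE; suff -> : elsym (fun i => l i + 0) S j = elsym l S j by [].
  by rewrite /elsym /elsym_gen; under eq_bigr do rewrite addr0.
(* The sum alone already makes every shifted variable nonnegative; the extra [1] makes the value at
   least [1]. *)
pose b := 1 + \sum_i `|l i|.
have b0 : 0 <= b by rewrite addr_ge0 // sumr_ge0.
have pb : 0 < p.[b].
  rewrite pE; have -> : elsym (fun i => l i + b) S j =
      elsym (fun i => l i + \sum_i `|l i| + 1) S j.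
    by rewrite /elsym /elsym_gen; under eq_bigr do rewrite /b addrCA addrC.
  apply: lt_le_trans (elsym_shift_ge ler01 jS _); first by rewrite expr1n.
  move=> i _; apply: elsym_ge0 => a _.
  rewrite (bigD1 a) //= addrA; apply: addr_ge0; last exact: sumr_ge0.
  by rewrite -lerBlDl sub0r -normrN ler_norm.
have [//|t tb /rootP pt] := @poly_ivt R p 0 b b0 _.
  by rewrite !ltW.
exists t; last by rewrite -pE.
move: tb => /andP[t0 _]; rewrite lt_neqAle t0 andbT.
by apply: contraTneq p0 => e; rewrite [in p.[0]]e pt ltxx.
Qed.

(* Chebyshev's sum inequality: [l i] and [elsym l (S :\ i) m.+1] are oppositely
   ordered, because their differences have ratio [- elsym l (S :\ i :\ j) m]. *)
Lemma elsym_chebyshev l S m :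
  (forall i j, i \in S -> j \in S :\ i -> 0 <= elsym l (S :\ i :\ j) m) ->
  #|S|%:R * (m.+2%:R * elsym l S m.+2) <=
  elsym l S 1 * ((#|S|%:R - m.+1%:R) * elsym l S m.+1).
Proof.
move=> H.
rewrite -sum_elsymD1_mul -sum_elsymD1 elsym1 -subr_ge0.
set s := fun i => elsym l (S :\ i) m.+1.
(* The defect as half a double sum of products of differences, whose sign is decided termwise. *)
have E : (\sum_(i in S) l i) * (\sum_(i in S) s i) -
   #|S|%:R * (\sum_(i in S) l i * s i) =
   2^-1 * \sum_(i in S) \sum_(j in S) (l i - l j) * (s j - s i).
  have -> : \sum_(i in S) \sum_(j in S) (l i - l j) * (s j - s i) =
    \sum_(i in S) \sum_(j in S) l i * s j - \sum_(i in S) \sum_(j in S) l i * s i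
    - (\sum_(i in S) \sum_(j in S) l j * s j -
       \sum_(i in S) \sum_(j in S) l j * s i).
    rewrite -!sumrB; apply: eq_bigr => i _; rewrite -!sumrB.
    by apply: eq_bigr => j _; ring.
  rewrite [X in _ - (_ - X)]exchange_big /=.
  have -> : \sum_(i in S) \sum_(j in S) l i * s j =
     (\sum_(i in S) l i) * (\sum_(i in S) s i) by rewrite big_distrlr.
  have -> : \sum_(i in S) \sum_(j in S) l i * s i =
     #|S|%:R * (\sum_(i in S) l i * s i).
    by rewrite mulr_sumr; apply: eq_bigr => i _; rewrite sumr_const mulr_natl.
  rewrite sumr_const -[X in _ - (X - _)]mulr_natl.
  by field.
rewrite E mulr_ge0 ?invr_ge0 // sumr_ge0 // => i iS; rewrite sumr_ge0 // => j jS.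
have [->|ij] := eqVneq i j; first by rewrite subrr mul0r.
have jSi : j \in S :\ i by rewrite !inE eq_sym ij.
have iSj : i \in S :\ j by rewrite !inE ij.
rewrite /s (elsymD1S _ _ jSi) (elsymD1S _ _ iSj).
have -> : S :\ j :\ i = S :\ i :\ j by rewrite !finset.setDDl finset.setUC.
set A := elsym _ _ m.+1; set B := elsym _ _ m.
have -> : (l i - l j) * (A + l i * B - (A + l j * B)) = (l i - l j) ^+ 2 * B.
  by ring.
by rewrite mulr_ge0 ?sqr_ge0 // H.
Qed.

(* If removing [i] made [elsym j] negative for a minimal [j], shifting all
   variables until it vanishes would leave [elsym j.+1 > 0 = elsym j] on
   [S :\ i], against Chebyshev's inequality for the smaller set. *)
Lemma elsym_removal_ge0 l S k :
  (forall j, (j <= k)%N -> 0 <= elsym l S j) ->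
  forall i j, i \in S -> (j < k)%N -> 0 <= elsym l (S :\ i) j.
Proof.
move: {2}#|S| (leqnn #|S|) => s; elim: s l S k => [|s IH] l S k.
  by rewrite leqn0 cards_eq0 => /eqP -> _ i j; rewrite inE.
move=> cS H i j0 iS j0k; rewrite leNgt; apply/negP => j0neg.
have cS' : (#|S :\ i| <= s)%N by move: cS; rewrite (cardsD1 i) iS.
have ex : exists j, (j < k)%N && (elsym l (S :\ i) j < 0).
  by exists j0; rewrite j0k.
case: (ex_minnP ex) => j /andP[jk jneg] jmin {j0 j0k j0neg ex}.
have sge j' : (j' < j)%N -> 0 <= elsym l (S :\ i) j'.
  move=> jj; rewrite leNgt; apply/negP => n.
  by have := jmin j'; rewrite n (ltn_trans jj jk) leqNgt jj => /(_ isT).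
case: j => [|j] in jk jneg jmin sge *; first by rewrite elsym0 ltr10 in jneg.
have jS : (j.+1 <= #|S :\ i|)%N.
  by rewrite leqNgt; apply/negP => h; rewrite elsym_eq0 ?ltxx in jneg.
have [t t0 tj] := elsym_shift_root jS jneg.
pose l' a := l a + t.
(* Strictness comes from the shift: on the whole of [S] the value is at least [t ^+ j.+2]. Since
   degree [j.+1] vanishes on [S :\ i], deleting [i] does not change degree [j.+2]. *)
have pos : 0 < elsym l' S j.+2.
  apply: lt_le_trans (elsym_shift_ge (ltW t0) _ _); first by rewrite exprn_gt0.
    by rewrite (cardsD1 i) iS add1n.
  by move=> a aj; apply: H; exact: leq_trans jk.
have pos' : 0 < elsym l' (S :\ i) j.+2.
  by move: pos; rewrite (elsymD1S _ _ iS) tj mulr0 addr0.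
have cone a : (a <= j.+2)%N -> 0 <= elsym l' (S :\ i) a.
  rewrite leq_eqVlt => /orP[/eqP ->|]; first exact: ltW.
  rewrite ltnS leq_eqVlt => /orP[/eqP ->|]; first by rewrite tj.
  rewrite ltnS => aj; apply: (@elsym_shift_ge0 l (S :\ i) t j) => //.
  exact: ltW.
(* The right side is [0] and the left side positive. The side condition deletes two more variables,
   which the induction hypothesis allows because it is applied to sets smaller than [S]. *)
have := @elsym_chebyshev l' (S :\ i) j; rewrite [elsym l' _ j.+1]tj !mulr0.
rewrite leNgt !mulr_gt0 ?ltr0n //; last by apply: leq_trans jS.
suff h : forall a b, a \in S :\ i -> b \in S :\ i :\ a ->
  0 <= elsym l' (S :\ i :\ a :\ b) j by move/(_ h).
move=> a b aS bS; apply: (IH _ _ j.+1) => //.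
  by rewrite (leq_trans _ cS') // (subset_leq_card (subD1set _ _)).
by move=> c cj; apply: (IH _ _ j.+2).
Qed.

End ElementarySymmetric.

(** * Inequalities between normalized symmetric functions *)

Section GardingCone.
Context {R : realType} {n : nat}.
Implicit Types (l : 'rV[R]_n).
Local Notation H := normalized_sigma.

Lemma sigmaE k l : sigma k l = elsym (l 0) [set: 'I_n]%SET k.
Proof.
rewrite /elsym /elsym_gen (eq_bigl xpredT) => [|i]; last by rewrite !inE.
under eq_bigr do rewrite addrC.
rewrite bigA_distr coef_sum /sigma big_mkcond /=; apply: eq_bigr => I _.
have -> : \prod_i (if i \in I then l 0 i *: 'X else 1) =
    (\prod_(i in I) l 0 i) *: 'X^#|I| :> {poly R}.
  rewrite -big_mkcond /=.
  by rewrite scaler_prod prodr_const.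
by rewrite coefZ coefXn eq_sym; case: eqP => _; rewrite ?mulr1 ?mulr0.
Qed.

Lemma normalized_sigma0 l : H 0 l = 1.
Proof. by rewrite /normalized_sigma sigmaE elsym0 bin0 divr1. Qed.

Lemma normalized_sigma1 l : H 1 l = (\sum_i l 0 i) / n%:R.
Proof.
rewrite /normalized_sigma sigmaE elsym1 bin1; congr (_ / _).
by apply: eq_bigl => i; rewrite inE.
Qed.

Lemma sigma_normalized m l : (m <= n)%N -> sigma m l = 'C(n, m)%:R * H m l.
Proof.
by move=> mn; rewrite mulrC divfK // pnatr_eq0 -lt0n bin_gt0.
Qed.

Lemma Garding_normalized_gt0 k l i : (k <= n)%N -> Garding_cone k l ->
  (i <= k)%N -> 0 < H i l.
Proof.
move=> kn cone ik; case: i ik => [|i] ik; first by rewrite normalized_sigma0.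
by rewrite divr_gt0 ?cone // ltr0n bin_gt0 (leq_trans ik).
Qed.

(** Chebyshev's inequality for all [n] variables; the normalization is such that all its numerical
    factors cancel. *)
Lemma Garding_maclaurin_step k l m : (k <= n)%N -> Garding_cone k l ->
  (m < k)%N -> H m.+1 l <= H 1 l * H m l.
Proof.
move=> kn cone mk; case: m mk => [|m] mk.
  by rewrite normalized_sigma0 mulr1.
have H0 i : (i <= k)%N -> 0 <= elsym (l 0) [set: 'I_n]%SET i.
  by case: i => [|i] ik; rewrite ?elsym0 // -sigmaE ltW // cone.
have := @elsym_chebyshev _ _ (l 0) [set: 'I_n]%SET m.
rewrite -!sigmaE !sigma_normalized ?(leq_trans _ kn) ?(leq_trans _ mk) //.
rewrite cardsT card_ord bin1.
have -> : m.+2%:R * ('C(n, m.+2)%:R * H m.+2 l) =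
   (n%:R - m.+1%:R) * ('C(n, m.+1)%:R * H m.+2 l).
  rewrite !mulrA -natrB ?(leq_trans (ltnW mk)) // -!natrM.
  by rewrite mul_bin_left.
have n0 : 0 < n%:R :> R by rewrite ltr0n; lia.
have c0 : 0 < 'C(n, m.+1)%:R :> R by rewrite ltr0n bin_gt0; lia.
have m0 : 0 < n%:R - m.+1%:R :> R by rewrite subr_gt0 ltr_nat; lia.
(* Each deletion costs one order of nonnegativity, and [m.+2 <= k] pays for two. *)
have side (i j : 'I_n) : i \in [set: 'I_n]%SET -> j \in ([set: 'I_n] :\ i)%SET ->
    0 <= elsym (l 0) ([set: 'I_n] :\ i :\ j)%SET m.
  move=> iT jT; apply: (@elsym_removal_ge0 _ _ _ _ m.+1) => // a am.
  apply: (@elsym_removal_ge0 _ _ _ _ m.+2) => // b bm.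
  by apply: H0; exact: leq_trans mk.
move=> /(_ side); rewrite -subr_ge0 => cheb.
rewrite -subr_ge0 -(pmulr_rge0 _ n0) -(pmulr_rge0 _ c0) -(pmulr_rge0 _ m0).
by apply: le_trans cheb _; rewrite le_eqVlt; apply/orP; left; apply/eqP; ring.
Qed.

Lemma Garding_maclaurin k l i j : (k <= n)%N -> Garding_cone k l ->
  (i <= j <= k)%N -> H j l <= H i l * H 1 l ^+ (j - i).
Proof.
move=> kn cone /andP[ij jk]; rewrite -{1}(subnKC ij).
have : (i + (j - i) <= k)%N by rewrite subnKC.
elim: (j - i)%N => [|d IH] dk; first by rewrite addn0 mulr1.
rewrite addnS in dk *; apply: le_trans (Garding_maclaurin_step kn cone dk) _.
rewrite exprS [leRHS]mulrCA ler_wpM2l ?IH //; last exact: ltnW.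
by apply: ltW; apply: Garding_normalized_gt0 kn cone _; lia.
Qed.

(** Sum over [i] the nonnegative products of [l 0 i - c] with the symmetric function of degree [m]
    in the other variables; both resulting sums are known multiples of [sigma m.+1] and
    [sigma m]. *)
Lemma normalized_sigma_step_ge c l m : 0 <= c -> (forall i, c <= l 0 i) ->
  (m < n)%N -> c * H m l <= H m.+1 l.
Proof.
move=> c0 cl mn.
have n0 : 0 < n%:R :> R by rewrite ltr0n; lia.
have C0 : 0 < 'C(n, m)%:R :> R by rewrite ltr0n bin_gt0; lia.
have m0 : 0 < n%:R - m%:R :> R by rewrite subr_gt0 ltr_nat; lia.
have : c * ((#|[set: 'I_n]%SET|%:R - m%:R) * elsym (l 0) [set: 'I_n]%SET m) <=
    m.+1%:R * elsym (l 0) [set: 'I_n]%SET m.+1.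
  rewrite -sum_elsymD1_mul -sum_elsymD1 mulr_sumr ler_sum // => i _.
  rewrite ler_wpM2r // elsym_ge0 // => a _; exact: le_trans (cl a).
rewrite -!sigmaE !sigma_normalized // ?(ltnW mn) // cardsT card_ord.
have -> : m.+1%:R * ('C(n, m.+1)%:R * H m.+1 l) =
   (n%:R - m%:R) * ('C(n, m)%:R * H m.+1 l).
  by rewrite !mulrA -natrB ?(ltnW mn) // -!natrM mul_bin_left.
rewrite -subr_ge0 => h.
rewrite -subr_ge0 -(pmulr_rge0 _ C0) -(pmulr_rge0 _ m0).
by apply: le_trans h _; rewrite le_eqVlt; apply/orP; left; apply/eqP; ring.
Qed.

Lemma normalized_sigma_ge c l i j : 0 <= c -> (forall i, c <= l 0 i) ->
  (i <= j <= n)%N -> c ^+ (j - i) * H i l <= H j l.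
Proof.
move=> c0 cl /andP[ij jn]; rewrite -{2}(subnKC ij).
have : (i + (j - i) <= n)%N by rewrite subnKC.
elim: (j - i)%N => [|d IH] dk; first by rewrite addn0 mul1r.
rewrite addnS in dk *; apply: le_trans _ (normalized_sigma_step_ge c0 cl dk).
by rewrite exprS -mulrA ler_wpM2l ?IH // ltnW.
Qed.

(** Real powers are monotone, so it suffices to compare [j - i]-th powers, which is
    [Garding_maclaurin]. *)
Lemma Garding_quotient_ge k l i j : (k <= n)%N -> Garding_cone k l ->
  (i < j <= k)%N ->
  (H 1 l)^-1 <= (H i l / H j l) `^ ((j - i)%N%:R^-1).
Proof.
move=> kn cone /andP[ij jk].
have pos m : (m <= k)%N -> 0 < H m l by exact: Garding_normalized_gt0 kn cone.
have ji : (j - i)%N%:R != 0 :> R by rewrite pnatr_eq0; lia.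
have k1 : 0 < H 1 l by apply: pos; lia.
have i0 : 0 < H i l by apply: pos; lia.
have j0 : 0 < H j l by apply: pos; lia.
have -> : (H 1 l)^-1 = ((H 1 l)^-1 ^+ (j - i)) `^ ((j - i)%N%:R^-1).
  rewrite -powR_mulrn ?invr_ge0 ?(ltW k1) // -powRrM mulfV // powRr1 //.
  by rewrite invr_ge0 ltW.
apply: ge0_ler_powR; rewrite ?nnegrE ?invr_ge0 ?ler0n //.
- by rewrite exprn_ge0 // invr_ge0 ltW.
- by rewrite divr_ge0 ?ltW.
rewrite ler_pdivlMr // exprVn mulrC ler_pdivrMr ?exprn_gt0 //.
by apply: Garding_maclaurin kn cone _; lia.
Qed.

(** Meant for a farthest point from [o], with [c = (V - u) / u]. *)
Lemma Garding_quotient_le c k l i j : 0 < c -> (forall i, c <= l 0 i) ->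
  (k <= n)%N -> Garding_cone k l -> (i < j <= k)%N ->
  (H i l / H j l) `^ ((j - i)%N%:R^-1) <= c^-1.
Proof.
move=> c0 cl kn cone /andP[ij jk].
have pos m : (m <= k)%N -> 0 < H m l by exact: Garding_normalized_gt0 kn cone.
have ji : (j - i)%N%:R != 0 :> R by rewrite pnatr_eq0; lia.
have i0 : 0 < H i l by apply: pos; lia.
have j0 : 0 < H j l by apply: pos; lia.
have -> : c^-1 = (c^-1 ^+ (j - i)) `^ ((j - i)%N%:R^-1).
  rewrite -powR_mulrn ?invr_ge0 ?(ltW c0) // -powRrM mulfV // powRr1 //.
  by rewrite invr_ge0 ltW.
apply: ge0_ler_powR; rewrite ?nnegrE ?invr_ge0 ?ler0n //.
- by rewrite divr_ge0 ?ltW.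
- by rewrite exprn_ge0 // invr_ge0 ltW.
rewrite ler_pdivrMr // exprVn mulrC ler_pdivlMr ?exprn_gt0 // mulrC.
by apply: normalized_sigma_ge (ltW c0) cl _; lia.
Qed.

End GardingCone.

(** * Minkowski geometry *)

(** Lagrange's identity: twice the defect is the sum of the squares of all
    [a i * b j - a j * b i]. *)
Lemma sum_cauchy_schwarz (R : realFieldType) (I : finType) (a b : I -> R) :
  (\sum_i a i * b i) ^+ 2 <= (\sum_i a i ^+ 2) * (\sum_i b i ^+ 2).
Proof.
have : 0 <= \sum_i \sum_j (a i * b j - a j * b i) ^+ 2.
  by apply: sumr_ge0 => i _; apply: sumr_ge0 => j _; exact: sqr_ge0.
have -> : \sum_i \sum_j (a i * b j - a j * b i) ^+ 2 =
   \sum_i \sum_j a i ^+ 2 * b j ^+ 2 - 2 * (\sum_i \sum_j (a i * b i) * (a j * b j))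
   + \sum_i \sum_j b i ^+ 2 * a j ^+ 2.
  rewrite mulr_sumr -sumrB -big_split; apply: eq_bigr => i _ /=.
  rewrite mulr_sumr -sumrB -big_split; apply: eq_bigr => j _ /=; ring.
rewrite -!big_distrlr /= expr2; lra.
Qed.

Section Minkowski.
Context {R : realType} {n : nat}.
Local Notation E := 'rV[R]_n.+2.
Implicit Types (x y o v w N : E).

Lemma minkC v w : mink v w = mink w v.
Proof. by rewrite /mink mulrC; under eq_bigr do rewrite mulrC. Qed.

Lemma minkDl v v' w : mink (v + v') w = mink v w + mink v' w.
Proof.
rewrite /mink !mxE; under eq_bigr do rewrite !mxE mulrDl.
by rewrite big_split /=; ring.
Qed.

Lemma minkZl a v w : mink (a *: v) w = a * mink v w.
Proof.
rewrite /mink !mxE; under eq_bigr do rewrite !mxE -mulrA.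
by rewrite -mulr_sumr; ring.
Qed.

Lemma minkNl v w : mink (- v) w = - mink v w.
Proof. by rewrite -scaleN1r minkZl mulN1r. Qed.

Lemma mink0l w : mink 0 w = 0.
Proof. by rewrite -(scale0r w) minkZl mul0r. Qed.

Lemma minkDr v w w' : mink v (w + w') = mink v w + mink v w'.
Proof. by rewrite !(minkC v) minkDl. Qed.

Lemma minkZr a v w : mink v (a *: w) = a * mink v w.
Proof. by rewrite !(minkC v) minkZl. Qed.

Lemma minkNr v w : mink v (- w) = - mink v w.
Proof. by rewrite !(minkC v) minkNl. Qed.

Lemma mink_suml (I : finType) (F : I -> E) w :
  mink (\sum_i F i) w = \sum_i mink (F i) w.
Proof.
by apply: (big_morph (mink^~ w)) => [u v|]; [exact: minkDl | exact: mink0l].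
Qed.

Lemma mink_sumr (I : finType) (F : I -> E) w :
  mink w (\sum_i F i) = \sum_i mink w (F i).
Proof. by rewrite minkC mink_suml; apply: eq_bigr => i _; exact: minkC. Qed.

Definition minkE := (minkDl, minkDr, minkNl, minkNr, minkZl, minkZr).

Lemma mink_nondegenerate w : (forall v, mink v w = 0) -> w = 0.
Proof.
move=> H; apply/rowP => i; rewrite mxE.
have := H (delta_mx 0 i); rewrite /mink mxE eqxx /=.
case: (unliftP ord0 i) => [j ->|->].
  rewrite (bigD1 j) //= !mxE !eqxx /= big1 => [|k kj].
    by rewrite mul1r addr0 mul0r oppr0 add0r.
  rewrite !mxE eqxx /= (inj_eq lift_inj) (negPf kj) mul0r //.
rewrite eqxx mul1r big1 => [/eqP|j _]; last by rewrite mxE mul0r.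
by rewrite addr0 oppr_eq0 => /eqP.
Qed.

Lemma sqr_spatial x : mink x x = -1 ->
  x 0 0 ^+ 2 - 1 = \sum_(i < n.+1) x 0 (lift ord0 i) ^+ 2.
Proof.
by move=> <-; rewrite /mink addrA expr2 subrr add0r.
Qed.

(** The complement of a timelike vector is spacelike: orthogonality identifies [x 0 0 * w 0 0] with
    the spatial product, and Cauchy-Schwarz with [x 0 0 ^+ 2 = P + 1] gives
    [Q <= x 0 0 ^+ 2 * mink w w]. The definiteness of the induced metric comes from here. *)
Lemma mink_orthogonal_timelike x w : mink x x = -1 -> mink x w = 0 ->
  0 <= mink w w /\ (mink w w = 0 -> w = 0).
Proof.
rewrite /mink => xx xw.
pose P := \sum_(i < n.+1) x 0 (lift ord0 i) ^+ 2.
pose Q := \sum_(i < n.+1) w 0 (lift ord0 i) ^+ 2.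
have cs := sum_cauchy_schwarz (fun i : 'I_n.+1 => x 0 (lift ord0 i))
   (fun i => w 0 (lift ord0 i)); rewrite -/P -/Q in cs.
set B := \sum_i _ in xw cs.
have eP : \sum_(i < n.+1) x 0 (lift ord0 i) * x 0 (lift ord0 i) = P by [].
have eQ : \sum_(i < n.+1) w 0 (lift ord0 i) * w 0 (lift ord0 i) = Q by [].
rewrite eP in xx; rewrite eQ.
have Q0 : 0 <= Q by apply: sumr_ge0 => i _; exact: sqr_ge0.
have P0 : 0 <= P by apply: sumr_ge0 => i _; exact: sqr_ge0.
have eB : B = x 0 0 * w 0 0 by lra.
have x1 : x 0 0 ^+ 2 = P + 1 by rewrite expr2; lra.
have key : Q <= x 0 0 ^+ 2 * (- (w 0 0 * w 0 0) + Q).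
  have -> : x 0 0 ^+ 2 * (- (w 0 0 * w 0 0) + Q) =
    x 0 0 ^+ 2 * Q - (x 0 0 * w 0 0) ^+ 2 by ring.
  rewrite -eB x1; lra.
have x0 : 0 < x 0 0 ^+ 2 by lra.
split; first by rewrite -(pmulr_rge0 _ x0); lra.
move=> ww0; rewrite ww0 mulr0 in key.
have Qe : Q = 0 by lra.
have wi i : w 0 (lift ord0 i) = 0.
  apply/eqP; rewrite -sqrf_eq0; apply/eqP.
  exact: (psumr_eq0P (P := xpredT) (F := fun i => w 0 (lift ord0 i) ^+ 2)
            (fun i _ => sqr_ge0 _) Qe).
apply/rowP => i; rewrite mxE; case: (unliftP ord0 i) => [j -> //|->].
by move: ww0; rewrite Qe addr0 => /eqP; rewrite oppr_eq0 mulf_eq0 orbb => /eqP.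
Qed.

(** The part of [y] tangent at [x] has square [mink x y ^+ 2 - 1], which must be nonnegative; the
    sign of [mink x y] is settled by both points lying on the upper sheet. *)
Lemma hyperbolic_mink_le x y : hyperbolic_space R n x -> hyperbolic_space R n y ->
  mink x y <= -1 /\ (mink x y = -1 -> x = y).
Proof.
move=> [xx x0] [yy y0].
have [] := @mink_orthogonal_timelike x (y + mink x y *: x) xx.
  by rewrite !minkE xx; ring.
have -> : mink (y + mink x y *: x) (y + mink x y *: x) = mink x y ^+ 2 - 1.
  by rewrite !minkE (minkC y x) xx yy; ring.
have neg : mink x y < 0.
  have cs := sum_cauchy_schwarz (fun i : 'I_n.+1 => x 0 (lift ord0 i))
    (fun i => y 0 (lift ord0 i)).
  have ex : \sum_(i < n.+1) x 0 (lift ord0 i) ^+ 2 = x 0 0 ^+ 2 - 1.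
    by rewrite -(sqr_spatial xx).
  have ey : \sum_(i < n.+1) y 0 (lift ord0 i) ^+ 2 = y 0 0 ^+ 2 - 1.
    by rewrite -(sqr_spatial yy).
  rewrite ex ey in cs.
  rewrite /mink addrC subr_lt0; set B := \sum_i _ in cs *.
  have xy : 0 < x 0 0 * y 0 0 by exact: mulr_gt0.
  have X1 : 1 <= x 0 0 ^+ 2.
    by rewrite -subr_ge0 -ex; apply: sumr_ge0 => i _; exact: sqr_ge0.
  have Y1 : 1 <= y 0 0 ^+ 2.
    by rewrite -subr_ge0 -ey; apply: sumr_ge0 => i _; exact: sqr_ge0.
  rewrite ltNge; apply/negP => h.
  have : (x 0 0 * y 0 0) ^+ 2 <= B ^+ 2 by rewrite ler_sqr ?nnegrE; lra.
  rewrite exprMn; nra.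
move=> h1 h2; split; first by nra.
move=> e; move: h2; rewrite e sqrrN expr1n subrr => /(_ erefl) /eqP.
by rewrite scaleN1r subr_eq0 eq_sym => /eqP.
Qed.

Lemma cosh_arcosh (t : R) : 1 <= t -> cosh (arcosh t) = t.
Proof.
move=> t1; rewrite /cosh /arcosh expRN.
set s := Num.sqrt _.
have s0 : 0 <= s by exact: sqrtr_ge0.
have s2 : s ^+ 2 = t ^+ 2 - 1 by rewrite sqr_sqrtr // subr_ge0 expr_ge1 //; lra.
have ts : 0 < t + s by lra.
rewrite lnK ?posrE //.
have -> : (t + s)^-1 = t - s.
  apply: (mulfI (lt0r_neq0 ts)); rewrite mulfV ?lt0r_neq0 //.
  have -> : (t + s) * (t - s) = t ^+ 2 - s ^+ 2 by ring.
  by rewrite s2; ring.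
lra.
Qed.

Lemma arcosh_ge0 (t : R) : 1 <= t -> 0 <= arcosh t.
Proof. by move=> t1; rewrite /arcosh ln_ge0 // ler_wpDr ?sqrtr_ge0. Qed.

Lemma arcosh_gt0 (t : R) : 1 < t -> 0 < arcosh t.
Proof.
by move=> t1; rewrite /arcosh ln_gt0 // (lt_le_trans t1) // lerDl sqrtr_ge0.
Qed.

Lemma ler_cosh (s t : R) : 0 <= s -> s <= t -> cosh s <= cosh t.
Proof.
move=> s0 st; rewrite /cosh ler_pM2r ?invr_gt0 // !expRN.
have es : 1 <= expR s by rewrite -expR0 ler_expR.
have est : expR s <= expR t by rewrite ler_expR.
have i1 : (expR s)^-1 <= 1 by rewrite invf_le1 // expR_gt0.
rewrite -subr_ge0.
have -> : expR t + (expR t)^-1 - (expR s + (expR s)^-1) =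
  (expR t - expR s) * (1 - (expR s)^-1 * (expR t)^-1).
  by field; rewrite !gt_eqF ?expR_gt0.
rewrite mulr_ge0 ?subr_ge0 // mulr_ile1 ?invr_ge0 ?expR_ge0 //.
by rewrite invf_le1 ?expR_gt0 // (le_trans es).
Qed.

Lemma sinh_gt0 (t : R) : 0 < t -> 0 < sinh t.
Proof.
by move=> t0; rewrite /sinh divr_gt0 // subr_gt0 ltr_expR; lra.
Qed.

Lemma cosh_hdist x y : hyperbolic_space R n x -> hyperbolic_space R n y ->
  cosh (hdist x y) = - mink x y.
Proof.
by move=> hx hy; rewrite cosh_arcosh // lerNr; have [] := hyperbolic_mink_le hx hy.
Qed.

Lemma hdist_ge0 x y : hyperbolic_space R n x -> hyperbolic_space R n y ->
  0 <= hdist x y.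
Proof.
by move=> hx hy; rewrite arcosh_ge0 // lerNr; have [] := hyperbolic_mink_le hx hy.
Qed.

Lemma hdist_eq0 x y : hyperbolic_space R n x -> hyperbolic_space R n y ->
  hdist x y = 0 -> x = y.
Proof.
move=> hx hy h; have [_] := hyperbolic_mink_le hx hy; apply.
apply/eqP; rewrite -eqr_oppLR -cosh_hdist // h /cosh oppr0 expR0; apply/eqP; lra.
Qed.

(** Multiplying by [sinh] removes the singularity: at [x = o] both sides vanish. For [N] orthogonal
    to [x] it turns the support function into [- mink o N]. *)
Lemma sinh_radial_field o x : hyperbolic_space R n o -> hyperbolic_space R n x ->
  sinh (hdist o x) *: radial_field o x = - mink o x *: x - o.
Proof.
move=> ho hx; rewrite /radial_field cosh_hdist //.
have := hdist_ge0 ho hx; rewrite le_eqVlt => /orP[/eqP/esym h0|h0].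
  have ox := hdist_eq0 ho hx h0.
  rewrite h0 {1}/sinh oppr0 subrr mul0r scale0r ox.
  by case: hx => -> _; rewrite opprK scale1r subrr.
by rewrite scalerA mulfV ?scale1r // gt_eqF // sinh_gt0.
Qed.

(* [V^2 - u^2 - 1] is the squared length of the component of [o] tangent to
   the hypersurface. *)
Lemma mink_normal_lt o x N : hyperbolic_space R n o -> hyperbolic_space R n x ->
  mink N x = 0 -> mink N N = 1 -> - mink o N < - mink o x.
Proof.
move=> ho hx Nx NN; have [ox _] := hyperbolic_mink_le ho hx.
case: (ho) => oo _; case: (hx) => xx _.
pose w := o + mink o x *: x - mink o N *: N.
have [] := @mink_orthogonal_timelike x w xx.
  by rewrite /w !minkE xx (minkC x o) (minkC x N) Nx; ring.
have -> : mink w w = mink o x ^+ 2 - mink o N ^+ 2 - 1.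
  by rewrite /w !minkE xx oo NN (minkC x o) (minkC x N) (minkC N o) Nx; ring.
by move=> h _; nra.
Qed.

End Minkowski.

(** * The strong minimum principle *)

Section SecondDerivativeTest.
Context {R : realType}.

(** Here [g] is the derivative of [f]. Were its own derivative at [0] negative, [g] would be
    negative just to the right of [0], and the mean value theorem would bring [f] below [f 0]. *)
Lemma second_derivative_test1 (f g : R -> R) (e : R) : 0 < e ->
  (forall t : R, `|t| < e -> is_derive t 1 f (g t)) -> derivable g 0 1 ->
  (forall t : R, `|t| < e -> f 0 <= f t) -> g 0 = 0 /\ 0 <= 'D_1 g 0.
Proof.
move=> e0 df dg fmin.
have inE (t : R) : t \in `](- e), e[%R = (`|t| < e) by rewrite in_itv /= ltr_norml.
have g0 : g 0 = 0.
  have d0 : is_derive (0 : R) (1 : R) f 0.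
    apply: (@derive1_at_min R f (- e) e 0).
    - lra.
    - by move=> t; rewrite inE => te; have := df t te => -[].
    - by rewrite inE normr0.
    - by move=> t; rewrite inE; exact: fmin.
  have d1 : is_derive (0 : R) (1 : R) f (g 0) by apply: df; rewrite normr0.
  by rewrite -(@derive_val _ _ _ _ _ _ _ d1) (@derive_val _ _ _ _ _ _ _ d0).
split=> //; rewrite leNgt; apply/negP => neg.
have : (fun h : R => h^-1 *: (g (h *: 1 + 0) - g 0)) @ 0^' --> 'D_1 g 0.
  exact: dg.
move/cvgr_lt => /(_ 0 neg).
rewrite near_withinE => /nbhs_ballP[d /= d0 hd].
pose m := Num.min d e / 2.
have [m0 md me] : [/\ 0 < m, m < d & m < e].
  have : 0 < Num.min d e by rewrite lt_min d0 e0.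
  have : Num.min d e <= d by rewrite ge_min lexx.
  have : Num.min d e <= e by rewrite ge_min lexx orbT.
  rewrite /m => *; split; lra.
have gneg h : 0 < h -> h < d -> g h < 0.
  move=> h0 hd'; have := hd h; rewrite /ball /= sub0r normrN gtr0_norm // => /(_ hd').
  rewrite gt_eqF // => /(_ isT).
  rewrite g0 subr0 addr0 [_ *: 1]mulr1 /GRing.scale /=.
  by rewrite pmulr_rlt0 // invr_gt0.
have [||c cm] := @MVT R f g 0 m m0.
- move=> x; rewrite in_itv /= => /andP[x0 xm]; apply: df.
  by rewrite gtr0_norm // (lt_trans xm).
- apply: derivable_within_continuous => x; rewrite in_itv /= => /andP[x0 xm].
  have := df x; rewrite ger0_norm // => /(_ (le_lt_trans xm me)) [] //.
rewrite subr0 => fm; move: cm; rewrite in_itv /= => /andP[c0 cm].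
have : f m < f 0.
  by rewrite -subr_lt0 fm pmulr_llt0 // gneg // (lt_trans cm).
by rewrite ltNge fmin // gtr0_norm.
Qed.

Context {n : nat}.
Implicit Types (F : 'rV[R]_n -> R) (G : 'I_n -> 'rV[R]_n -> R) (q v : 'rV[R]_n).
Local Notation e_ j := (delta_mx 0 j : 'rV[R]_n).

Lemma derive_coord_sum F q v : differentiable F q ->
  'D_v F q = \sum_j v 0 j * 'D_(e_ j) F q.
Proof.
move=> dF; rewrite deriveE // {1}(row_sum_delta v) linear_sum.
by apply: eq_bigr => j _; rewrite linearZ deriveE.
Qed.

Lemma is_derive_line F q v t : differentiable F (q + t *: v) ->
  is_derive t 1 (fun s : R => F (q + s *: v)) ('D_v F (q + t *: v)).
Proof.
move=> dF.
have dl : is_diff t (fun s : R => q + s *: v) (fun s : R => s *: v).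
  apply: is_diff_eq; last by apply/funext => s /=; rewrite add0r.
have dF' : is_diff (q + t *: v) F ('d F (q + t *: v)) by exact: DiffDef.
have [d1 d2] := is_diff_comp dl dF'.
apply: DeriveDef; first exact: diff_derivable.
by rewrite deriveE // d2 /= scale1r deriveE.
Qed.

(** Restriction to the line through [q] in direction [v]. The partial derivatives enter as functions
    [G j] of their own because they are differentiated again. *)
Lemma second_derivative_test F G q v :
  (\forall z \near q, differentiable F z /\ forall j, 'D_(e_ j) F z = G j z) ->
  (forall j, differentiable (G j) q) ->
  (\forall z \near q, F q <= F z) ->
  \sum_j v 0 j * G j q = 0 /\
  0 <= \sum_i \sum_j v 0 i * v 0 j * 'D_(e_ i) (G j) q.
Proof.
move=> dF dG Fmin.
pose g (t : R) := \sum_j v 0 j * G j (q + t *: v).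
have lim0 : (fun t : R => q + t *: v) @ (0 : R) --> q.
  suff : (fun t : R => q + t *: v) @ (0 : R) --> q + (0 : R) *: v.
    by rewrite scale0r addr0.
  apply: (@cvgD _ _ _ _ _ (fun=> q) (fun t : R => t *: v)); first exact: cvg_cst.
  exact: scalel_continuous.
have : \forall t \near (0 : R), (differentiable F (q + t *: v) /\
    forall j, 'D_(e_ j) F (q + t *: v) = G j (q + t *: v)) /\ F q <= F (q + t *: v).
  exact: lim0 _ (filterI dF Fmin).
move=> /nbhs_ballP[e /= e0 he].
have he' (t : R) : `|t| < e -> [/\ differentiable F (q + t *: v),
   forall j, 'D_(e_ j) F (q + t *: v) = G j (q + t *: v) & F q <= F (q + t *: v)].
  by move=> te; have [|[? ?] ?] := he t; rewrite /ball /= ?sub0r ?normrN.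
have dg : is_derive (0 : R) (1 : R) g (\sum_j v 0 j * 'D_v (G j) q).
  have -> : g = \sum_j (v 0 j *: (fun t : R => G j (q + t *: v))).
    by apply/funext => t; rewrite fct_sumE.
  apply: is_derive_sum => j; apply: is_deriveZ.
  have q0 : q + (0 : R) *: v = q by rewrite scale0r addr0.
  have := @is_derive_line (G j) q v 0; rewrite q0; exact.
have [] := @second_derivative_test1 (fun t => F (q + t *: v)) g e e0.
- move=> t /he'[dFt dGt _].
  have -> : g t = 'D_v F (q + t *: v).
    by rewrite derive_coord_sum //; apply: eq_bigr => j _; rewrite dGt.
  exact: is_derive_line.
- by case: dg.
- by move=> t /he'[_ _]; rewrite scale0r addr0.
rewrite [in X in X -> _]/g; under [in X in X -> _]eq_bigr do rewrite scale0r addr0.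
move=> ->; rewrite (@derive_val _ _ _ _ _ _ _ dg) => D; split=> //.
apply: le_trans D _; rewrite exchange_big le_eqVlt; apply/orP; left; apply/eqP.
apply: eq_bigr => j _ /=; rewrite derive_coord_sum // mulr_sumr.
by apply: eq_bigr => i _; rewrite mulrCA mulrA.
Qed.

End SecondDerivativeTest.

(** * Positive definite matrices *)

Section PositiveDefinite.
Context {R : rcfType}.

Definition quad m (a : 'M[R]_m) (v : 'rV[R]_m) : R := (v *m a *m v^T) 0 0.
Definition posdef m (a : 'M[R]_m) : Prop :=
  a^T = a /\ forall v, v != 0 -> 0 < quad a v.

Lemma quadE m (a : 'M[R]_m) v : quad a v = \sum_i \sum_j v 0 i * v 0 j * a i j.
Proof.
rewrite /quad mxE exchange_big; apply: eq_bigr => j _ /=.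
by rewrite !mxE mulr_suml; apply: eq_bigr => i _; rewrite mulrAC.
Qed.

Lemma mxtrace_1x1 (a : 'M[R]_1) : \tr a = a 0 0.
Proof. by rewrite /mxtrace big_ord1. Qed.

(** Cholesky factorization by induction on the size: splitting off the first row and column leaves
    the Schur complement [c], again positive definite. *)
Lemma posdef_sum_outer m (a : 'M[R]_m) : posdef a ->
  exists vs : seq 'rV[R]_m, a = \sum_(v <- vs) v^T *m v.
Proof.
elim: m a => [|m IH] a [asym apos].
  by exists [::]; rewrite big_nil; apply/matrixP => -[].
pose al := a 0 0; pose r : 'rV[R]_m := ursubmx (a : 'M[R]_(1 + m)).
pose b : 'M[R]_m := drsubmx (a : 'M[R]_(1 + m)).
have aE : a = block_mx (al%:M : 'M[R]_1) r r^T b.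
  have ul : @ulsubmx _ 1 m 1 m a = al%:M.
    by rewrite [LHS]mx11_scalar !mxE; congr (a _ _)%:M; apply: val_inj.
  have dl : @dlsubmx _ 1 m 1 m a = r^T by rewrite /r trmx_ursub asym.
  by rewrite -[LHS](@submxK _ 1 m 1 m) ul dl.
have al0 : 0 < al.
  have /apos : (delta_mx 0 0 : 'rV[R]_m.+1) != 0.
    by apply/eqP => /rowP /(_ 0); rewrite !mxE !eqxx; apply/eqP/oner_neq0.
  rewrite quadE (bigD1 0) //= [X in _ + X]big1 => [|i i0]; last first.
    by apply: big1 => j _; rewrite !mxE (negPf i0) mul0r mul0r.
  rewrite (bigD1 0) //= big1 => [|j j0]; last by rewrite !mxE (negPf j0) mulr0 mul0r.
  by rewrite !mxE !eqxx !mul1r !addr0.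
have bsym : b^T = b by rewrite /b -{2}asym trmx_drsub.
pose c := b - al^-1 *: (r^T *m r).
have [|vs cE] := IH c.
  split; first by rewrite /c linearB linearZ /= trmx_mul trmxK bsym.
  (* This [t] completes the square: it minimizes the form of [a] at [(t, v)], with minimal value
     [quad c v]. *)
  move=> v v0; pose t : 'rV[R]_1 := - (al^-1 *: (v *m r^T)).
  have /apos : (row_mx t v : 'rV_(1 + m)) != 0.
    apply: contraNneq v0 => /(congr1 rsubmx); rewrite row_mxKr => ->.
    by apply/eqP/rowP => i; rewrite !mxE.
  suff key : quad (block_mx al%:M r r^T b) (row_mx t v) = quad c v by rewrite aE key.
  have tr1 (s : 'M[R]_1) : s^T = s by rewrite [s]mx11_scalar tr_scalar_mx.
  have vr : v *m r^T = - (al *: t).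
    by rewrite /t scalerN opprK scalerA mulfV ?gt_eqF // scale1r.
  have rv : r *m v^T = - (al *: t).
    by rewrite -[LHS]trmxK trmx_mul trmxK vr tr1.
  rewrite /quad mul_row_block tr_row_mx mul_row_col.
  rewrite mul_mx_scalar vr subrr mul0mx add0r /c mulmxBr mulmxBl mulmxDl.
  rewrite -scalemxAr -scalemxAl mulmxA vr -!mulmxA rv.
  rewrite !mulmxA; congr ((_ : 'M[R]_1) 0 0).
  rewrite addrC; congr (_ + _).
  rewrite -!scaleNr -!scalemxAl -!scalemxAr !scalerA.
  by congr (_ *: _); field; rewrite gt_eqF.
exists (row_mx (Num.sqrt al)%:M ((Num.sqrt al)^-1 *: r) ::
        [seq row_mx 0 v : 'rV_(1 + m) | v <- vs]).
rewrite big_cons big_map aE; move: vs cE => vs cE.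
suff : block_mx al%:M r r^T b =
  (row_mx (Num.sqrt al)%:M ((Num.sqrt al)^-1 *: r))^T *m
   row_mx (Num.sqrt al)%:M ((Num.sqrt al)^-1 *: r) +
  \sum_(v <- vs) (row_mx 0 v : 'rV_(1 + m))^T *m row_mx 0 v by [].
rewrite tr_row_mx tr_scalar_mx linearZ /= mul_col_row.
under eq_bigr do rewrite tr_row_mx trmx0 mul_col_row !mul0mx mulmx0.
have -> : \sum_(v <- vs) block_mx 0 0 0 (v^T *m v) =
    block_mx (0 : 'M[R]_1) 0 0 c :> 'M[R]_(1 + m).
  rewrite cE; elim: vs {cE} => [|v vs IHs]; first by rewrite !big_nil block_mx0.
  by rewrite !big_cons IHs add_block_mx !addr0.
rewrite add_block_mx !addr0; congr block_mx.
- by rewrite -scalar_mxM -expr2 sqr_sqrtr // ltW.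
- by rewrite mul_scalar_mx scalerA mulfV ?scale1r // sqrtr_eq0 -ltNge.
- by rewrite mul_mx_scalar scalerA mulfV ?scale1r // sqrtr_eq0 -ltNge.
- rewrite -scalemxAl -scalemxAr scalerA -invfM -expr2 sqr_sqrtr ?(ltW al0) //.
  by rewrite /c addrC subrK.
Qed.

(** With [a] a sum of outer products of vectors [v], the trace is the sum of the values
    [quad h v]. *)
Lemma mxtrace_posdef_ge0 m (a h : 'M[R]_m) : posdef a ->
  (forall v, 0 <= quad h v) -> 0 <= \tr (a *m h).
Proof.
move=> /posdef_sum_outer[vs ->] h0.
rewrite mulmx_suml raddf_sum /=; apply: sumr_ge0 => v _.
by rewrite -mulmxA mxtrace_mulC mxtrace_1x1; exact: h0.
Qed.

Lemma posdef_unitmx m (a : 'M[R]_m) : posdef a -> a \in unitmx.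
Proof.
move=> [_ pos]; rewrite -row_free_unit -kermx_eq0.
apply/negPn/negP => /rowV0Pn[v /sub_kermxP va v0].
by have := pos v v0; rewrite /quad va mul0mx mxE ltxx.
Qed.

Lemma posdef_invmx m (a : 'M[R]_m) : posdef a -> posdef (invmx a).
Proof.
move=> pa; have ua := posdef_unitmx pa; case: pa => asym apos.
split; first by rewrite trmx_inv asym.
move=> v v0; have w0 : v *m invmx a != 0.
  by apply: contraNneq v0 => e; rewrite -(mulmxKV ua v) e mul0mx.
have := apos _ w0; rewrite /quad mulmxKV // trmx_mul trmx_inv asym.
by rewrite mulmxA.
Qed.

End PositiveDefinite.

(** * The Gaussian barrier and its derivatives *)

Section GaussianBarrier.
Context {R : realType} {n : nat}.
Implicit Types (x y v : 'rV[R]_n).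
Local Notation e_ j := (delta_mx 0 j : 'rV[R]_n).

Lemma rV_coord_norm_le v i : `|v 0 i| <= `|v|.
Proof.
rewrite [leRHS]/Num.Def.normr /= mx_normrE.
by apply: (le_bigmax _ (fun i : 'I_1 * 'I_n => `|v i.1 i.2|) (0, i)).
Qed.

Lemma rV_norm_le v (c : R) : 0 <= c -> (forall i, `|v 0 i| <= c) -> `|v| <= c.
Proof.
move=> c0 vc; rewrite [leLHS]/Num.Def.normr /= mx_normrE.
by apply: bigmax_le => // -[i j] _ /=; rewrite ord1.
Qed.

(** Euclidean, hence smooth, whereas the norm of row vectors is the maximum norm; comparing the two
    costs a factor [n]. *)
Definition sqdist y x : R := \sum_i (x 0 i - y 0 i) ^+ 2.

Lemma sqdist_le y x : sqdist y x <= n%:R * `|x - y| ^+ 2.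
Proof.
rewrite mulr_natl -[n in _ *+ n]card_ord -sumr_const; apply: ler_sum => i _.
rewrite -real_normK ?num_real // lerXn2r ?nnegrE //.
by have := rV_coord_norm_le (x - y) i; rewrite !mxE.
Qed.

Lemma norm_le_sqdist y x (c : R) : 0 <= c -> sqdist y x <= c ^+ 2 -> `|x - y| <= c.
Proof.
move=> c0 h; apply: rV_norm_le => // i; rewrite !mxE.
rewrite -(@ler_pXn2r _ 2) ?nnegrE // real_normK ?num_real //.
apply: le_trans h; rewrite /sqdist (bigD1 i) //= lerDl.
by apply: sumr_ge0 => j _; exact: sqr_ge0.
Qed.

Lemma is_derive_coord x v i : is_derive x v (fun x => x 0 i) (v 0 i).
Proof.
have d : differentiable (fun x : 'rV[R]_n => x 0 i) x by exact: differentiable_coord.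
apply: DeriveDef; first exact: diff_derivable.
have := derive_mx (@derivable_id _ 'rV[R]_n x v).
by rewrite derive_id => /rowP /(_ i); rewrite mxE.
Qed.

Lemma differentiable_sqdist y x : differentiable (sqdist y) x.
Proof.
have -> : sqdist y = \sum_i (fun x => (x 0 i - y 0 i)) ^+ 2.
  by apply/funext => z; rewrite fct_sumE.
apply: differentiable_sum => i; apply: differentiableX.
by apply: differentiableB => //; exact: differentiable_coord.
Qed.

Lemma derive_sqdist y x j : 'D_(e_ j) (sqdist y) x = 2 * (x 0 j - y 0 j).
Proof.
have -> : sqdist y = \sum_i (fun x => (x 0 i - y 0 i)) ^+ 2.
  by apply/funext => z; rewrite fct_sumE.
have D i : is_derive x (e_ j) ((fun x => (x 0 i - y 0 i)) ^+ 2 : _ -> R)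
    (2 * (x 0 i - y 0 i) * (e_ j) 0 i).
  have dc := is_derive_coord x (e_ j) i.
  have db : is_derive x (e_ j) (fun x => x 0 i - y 0 i) ((e_ j) 0 i).
    by apply: is_derive_eq; rewrite subr0.
  apply: is_derive_eq.
  by rewrite /GRing.scale /= expr1 mulr_natl.
rewrite (@derive_val _ _ _ _ _ _ _ (is_derive_sum D)).
rewrite (bigD1 j) //= big1 => [|i ij].
  by rewrite !mxE !eqxx mulr1 addr0.
by rewrite !mxE (negPf ij) andbF mulr0.
Qed.

Lemma differentiable_expR_comp (h : 'rV[R]_n -> R) x : differentiable h x ->
  differentiable (expR \o h) x /\
  forall v, 'D_v (expR \o h) x = expR (h x) * 'D_v h x.
Proof.
move=> dh.
have de : differentiable (expR : R -> R) (h x).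
  by apply/derivable1_diffP; exact: derivable_expR.
split; first exact: differentiable_comp.
move=> v; rewrite deriveE; last exact: differentiable_comp.
rewrite diff_comp //= deriveE // diff1E //.
  by rewrite derive1E derive_val /GRing.scale /= mulrC.
Qed.

Definition gaussian (al : R) y x : R := expR (- al * sqdist y x).
Definition gaussian_grad al y j x : R :=
  - (2 * al) * ((x 0 j - y 0 j) * gaussian al y x).

Lemma differentiable_gaussian al y x : differentiable (gaussian al y) x.
Proof.
have [] // := @differentiable_expR_comp (fun x => - al * sqdist y x) x _.
exact/differentiableZ/differentiable_sqdist.
Qed.

Lemma derive_gaussian al y x j :
  'D_(e_ j) (gaussian al y) x = gaussian_grad al y j x.
Proof.
have ds : differentiable (fun x => - al * sqdist y x) x.
  exact/differentiableZ/differentiable_sqdist.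
have [_ ->] := differentiable_expR_comp ds.
have -> : (fun x => - al * sqdist y x) = - al *: sqdist y by [].
rewrite deriveZ; last exact/diff_derivable/differentiable_sqdist.
rewrite derive_sqdist /gaussian_grad /gaussian /GRing.scale /=; ring.
Qed.

Lemma differentiable_gaussian_grad al y j x :
  differentiable (gaussian_grad al y j) x.
Proof.
apply/differentiableZ; apply: differentiableM.
  by apply: differentiableB => //; exact: differentiable_coord.
exact: differentiable_gaussian.
Qed.

Lemma derive_gaussian_grad al y i j x :
  'D_(e_ i) (gaussian_grad al y j) x =
  gaussian al y x * (4 * al ^+ 2 * ((x 0 i - y 0 i) * (x 0 j - y 0 j)) -
                     2 * al * (i == j)%:R).
Proof.
have dc := is_derive_coord x (e_ i) j.
have db : is_derive x (e_ i) (fun x => x 0 j - y 0 j) ((e_ i) 0 j).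
  by apply: is_derive_eq; rewrite subr0.
have dg : is_derive x (e_ i) (gaussian al y) (gaussian_grad al y i x).
  rewrite -derive_gaussian; apply/derivableP/diff_derivable.
  exact: differentiable_gaussian.
have dM := @is_deriveM _ _ _ _ x (e_ i) _ _ db dg.
have dZ := @is_deriveZ _ _ _ _ (- (2 * al)) x (e_ i) _ dM.
rewrite [LHS](@derive_val _ _ _ _ _ _ _ dZ) mxE eqxx /= eq_sym.
rewrite /gaussian_grad /GRing.scale /=; ring.
Qed.

End GaussianBarrier.

Lemma for_continuous_sum (R : realType) (T : topologicalType) (I : finType)
    (P : pred I) (f : I -> T -> R) (x : T) :
  (forall i, {for x, continuous (f i)}) ->
  {for x, continuous (fun z => \sum_(i | P i) f i z)}.
Proof. by move=> cf; apply: (cvg_big add_continuous) => i _; exact: cf. Qed.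

Lemma for_continuous_prod (R : realType) (T : topologicalType) (I : finType)
    (P : pred I) (f : I -> T -> R) (x : T) :
  (forall i, {for x, continuous (f i)}) ->
  {for x, continuous (fun z => \prod_(i | P i) f i z)}.
Proof. by move=> cf; apply: (cvg_big mul_continuous) => i _; exact: cf. Qed.

Section StrongMinimumPrinciple.
Context {R : realType} {n : nat}.
Local Notation e_ j := (delta_mx 0 j : 'rV[R]_n).

(* If [f y > f z0] for some [y] near [z0], compare [f] with a small multiple of
   [expR (- al * |x - y| ^ 2)] on an annulus around [y] containing [z0]: for
   large [al] the barrier is a strict subsolution there, so the difference has
   no interior minimum, yet it is smaller at [z0] than on the boundary. *)
Lemma strong_minimum_principle (U : set 'rV[R]_n) (f : 'rV[R]_n -> R)
    (G : 'I_n -> 'rV[R]_n -> R) (a : 'rV[R]_n -> 'M[R]_n)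
    (b : 'rV[R]_n -> 'rV[R]_n) (z0 : 'rV[R]_n) :
  open U -> U z0 ->
  (forall z, U z -> differentiable f z /\ forall j, 'D_(e_ j) f z = G j z) ->
  (forall z j, U z -> differentiable (G j) z) ->
  (forall z, U z -> posdef (a z)) ->
  (forall z i j, U z -> {for z, continuous (fun z => a z i j)}) ->
  (forall z j, U z -> {for z, continuous (fun z => b z 0 j)}) ->
  (forall z, U z -> \tr (a z *m \matrix_(i, j) 'D_(e_ i) (G j) z) +
                    \sum_j b z 0 j * G j z <= 0) ->
  (forall z, U z -> f z0 <= f z) -> \forall z \near z0, f z = f z0.
Proof.
move=> oU Uz0 df dG pa ca cb Lf fmin.
have /nbhs_ballP[r /= r0 rU] : nbhs z0 U by exact: open_nbhs_nbhs.
pose D : R := r / 2.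
(* Within [rho] of [z0] in the maximum norm, [y] has Euclidean distance less than [D] from [z0], as
   [n < n.+1 ^+ 2]; and the Euclidean ball of radius [D] around [y] stays in [U], as
   [rho + D <= r]. *)
pose rho : R := r / (2 * n.+1%:R).
have n0 : 0 < n.+1%:R :> R by rewrite ltr0n.
have D0 : 0 < D by rewrite /D; lra.
have rho0 : 0 < rho by rewrite /rho divr_gt0 // mulr_gt0.
have rhoE : rho * n.+1%:R = D by rewrite /rho /D; field; rewrite gt_eqF.
have rhoD : rho <= D by rewrite -rhoE ler_pMr // ler1n.
apply/nbhs_ballP; exists rho => //= y; rewrite -ball_normE /= => z0y.
apply/eqP; rewrite eq_le fmin ?andbT; last first.
  apply: rU; rewrite -ball_normE /=; apply: lt_le_trans z0y _.
  by rewrite (le_trans rhoD) // /D; lra.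
rewrite leNgt; apply/negP => fy.
have Uy : U y.
  apply: rU; rewrite -ball_normE /=; apply: lt_le_trans z0y _.
  by rewrite (le_trans rhoD) // /D; lra.
have sz0 : sqdist y z0 < D ^+ 2.
  apply: le_lt_trans (sqdist_le _ _) _.
  have h1 : `|z0 - y| ^+ 2 <= rho ^+ 2 by rewrite lerXn2r ?nnegrE // ltW.
  apply: (@le_lt_trans _ _ (n%:R * rho ^+ 2)); first by rewrite ler_wpM2l.
  have -> : D ^+ 2 = n.+1%:R ^+ 2 * rho ^+ 2 by rewrite -rhoE mulrC exprMn.
  by rewrite ltr_pM2r ?exprn_gt0 // expr2 -natrM ltr_nat; lia.
have inU x : sqdist y x <= D ^+ 2 -> U x.
  move=> /(norm_le_sqdist (ltW D0)) xy; apply: rU; rewrite -ball_normE /=.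
  have -> : z0 - x = (z0 - y) - (x - y) by rewrite opprB addrA subrK.
  apply: le_lt_trans (ler_normB _ _) _.
  have -> : r = D + D by rewrite /D; lra.
  by apply: ltr_leD => //; exact: lt_le_trans z0y rhoD.
have cf x : U x -> {for x, continuous f}.
  by move=> /df[dfx _]; exact: differentiable_continuous.
pose m := f z0.
have [de de0 hde] : exists2 de, 0 < de &
    forall x, sqdist y x <= de ^+ 2 -> (f y + m) / 2 < f x.
  have fy' : (f y + m) / 2 < f y by rewrite /m; lra.
  have /nbhs_ballP[d /= d0 hd] : \forall x \near y, (f y + m) / 2 < f x.
    by have /cvgr_gt := cf _ Uy; apply.
  exists (d / 2); first by rewrite divr_gt0.
  move=> x /(norm_le_sqdist _) xy; apply: hd; rewrite -ball_normE /= distrC.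
  apply: le_lt_trans (xy _) _; lra.
pose K := [set x | de ^+ 2 <= sqdist y x <= D ^+ 2].
have cs : continuous (sqdist y).
  by move=> x; apply: differentiable_continuous; exact: differentiable_sqdist.
have Kz0 : K z0.
  rewrite /K /= (ltW sz0) andbT leNgt; apply/negP => /ltW /hde.
  by rewrite /m => h; lra.
have KU x : K x -> U x by move=> /andP[_]; exact: inU.
have cK : compact K.
  apply: bounded_closed_compact.
    exists (D + `|y|); split; first exact: num_real.
    move=> M hM x /andP[_ /(norm_le_sqdist (ltW D0)) xy]; apply: ltW.
    apply: le_lt_trans hM; rewrite -(subrK y x).
    by apply: le_trans (ler_normD _ _) _; rewrite lerD2r.
  have -> : K = sqdist y @^-1` `[de ^+ 2, D ^+ 2].
    by apply/seteqP; split => x; rewrite /K /= in_itv.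
  by apply: (continuous_closedP (sqdist y)).1 => //; exact: interval_closed.
have cwK (h : 'rV[R]_n -> R) : (forall x, U x -> {for x, continuous h}) ->
    {within K, continuous h}.
  move=> ch; apply: continuous_in_subspaceT => x; rewrite inE => /KU; exact: ch.
have K0 : K !=set0 by exists z0.
have cC x i : {for x, continuous (fun x : 'rV[R]_n => x 0 i - y 0 i)}.
  by apply: continuousB; [exact: coord_continuous | exact: cst_continuous].
have cA : {within K, continuous (fun x => quad (a x) (x - y))}.
  apply: cwK => x Ux.
  have -> : (fun x => quad (a x) (x - y)) = fun x => \sum_i \sum_j
      (x 0 i - y 0 i) * (x 0 j - y 0 j) * a x i j.
    apply/funext => z; rewrite quadE; apply: eq_bigr => i _.
    by apply: eq_bigr => j _; rewrite !mxE.
  apply: for_continuous_sum => i; apply: for_continuous_sum => j.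
  by apply: continuousM (ca _ _ _ Ux); apply: continuousM; exact: cC.
have cB : {within K, continuous
    (fun x => \tr (a x) + \sum_j b x 0 j * (x 0 j - y 0 j))}.
  apply: cwK => x Ux; apply: continuousD.
    by apply: for_continuous_sum => i; exact: ca.
  by apply: for_continuous_sum => i; apply: continuousM; [exact: cb | exact: cC].
have [x1 /set_mem Kx1 minA] := EVT_min_rV K0 cK cA.
have [x2 _ maxB] := EVT_max_rV K0 cK cB.
set mu := quad _ _ in minA.
have mu0 : 0 < mu.
  have [_] := pa _ (KU _ Kx1); apply; apply/eqP => xy.
  have : sqdist y x1 = 0.
    apply: big1 => i _; have /rowP /(_ i) := xy.
    by rewrite !mxE => ->; rewrite expr0n.
  by case/andP: Kx1 => + _ => + e; rewrite e leNgt exprn_gt0.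
set C := _ + _ in maxB.
(* On [K], [mu] bounds the quadratic form at [x - y] from below and [C] bounds trace plus drift from
   above; this [al] makes the former dominate. *)
pose al := (`|C| + 1) / (2 * mu).
have al0 : 0 < al by rewrite divr_gt0 ?mulr_gt0 // ltr_wpDl.
have alC : C < 2 * al * mu.
  have -> : 2 * al * mu = `|C| + 1 by rewrite /al; field; rewrite gt_eqF.
  by rewrite (le_lt_trans (ler_norm C)) // ltrDl.
pose w := gaussian al y.
(* On the inner sphere [f] exceeds [(f y + m) / 2] and [w <= 1], so there [F] stays above [m]. *)
pose ep := (f y - m) / 2.
have ep0 : 0 < ep by rewrite /ep divr_gt0 // subr_gt0.
pose F := fun x => f x - ep * w x.
have cF : {within K, continuous F}.
  apply: cwK => x Ux; apply: continuousB; first exact: cf.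
  apply: differentiable_continuous; apply: differentiableZ.
  exact: differentiable_gaussian.
have [q /set_mem Kq minF] := EVT_min_rV K0 cK cF.
have Uq := KU _ Kq.
(* The value at [z0], strictly inside the outer sphere, is below this bound, while on the outer
   sphere [F] is at least the bound. *)
have Fq : F q < m - ep * expR (- al * D ^+ 2).
  apply: le_lt_trans (minF z0 _) _; first exact/mem_set.
  rewrite /F -/m ltrD2l ltrN2 ltr_pM2l // ltr_expR.
  by rewrite !mulNr ltrN2 ltr_pM2l.
have qD : sqdist y q < D ^+ 2.
  case/andP: (Kq) => _; rewrite le_eqVlt => /orP[/eqP e|//].
  move: Fq; rewrite /F /w /gaussian e ltrD2r ltNge.
  by rewrite fmin.
have dq : de ^+ 2 < sqdist y q.
  case/andP: (Kq) => + _; rewrite le_eqVlt => /orP[/eqP e|//].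
  have fq : (f y + m) / 2 < f q by apply: hde; rewrite e.
  have w1 : w q <= 1.
    rewrite -expR0 ler_expR mulNr oppr_le0 mulr_ge0 ?(ltW al0) // -e.
    by rewrite exprn_ge0 // ltW.
  have p0 : 0 < ep * expR (- al * D ^+ 2) by rewrite mulr_gt0 ?expR_gt0.
  have epw : ep * w q <= ep by rewrite ler_piMr // ltW.
  have epE : ep = (f y - m) / 2 by [].
  clearbody ep; move: Fq; rewrite /F => Fq; lra.
have nearK : \forall x \near q, K x.
  have c1 : \forall x \near q, de ^+ 2 < sqdist y x.
    by have /cvgr_gt := cs q; apply.
  have c2 : \forall x \near q, sqdist y x < D ^+ 2.
    by have /cvgr_lt := cs q; apply.
  by near=> x; rewrite /K /=; apply/andP; split; apply: ltW; near: x.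
pose GF (j : 'I_n) := fun x => G j x - ep * gaussian_grad al y j x.
have dF z : U z -> differentiable F z /\ forall j, 'D_(e_ j) F z = GF j z.
  move=> Uz; have [dfz Gz] := df z Uz.
  have dw : differentiable (ep *: w) z.
    exact/differentiableZ/differentiable_gaussian.
  split; first exact: differentiableB.
  move=> j; have -> : F = f - (ep *: w) by [].
  rewrite deriveB; [|exact: diff_derivable..].
  rewrite Gz deriveZ; last exact/diff_derivable/differentiable_gaussian.
  by rewrite derive_gaussian.
have dGg j : differentiable (ep *: gaussian_grad al y j) q.
  exact/differentiableZ/differentiable_gaussian_grad.
have dGF j : differentiable (GF j) q.
  by apply: differentiableB; [exact: dG | exact: dGg].
have nearF : \forall z \near q, differentiable F z /\
    forall j, 'D_(e_ j) F z = GF j z.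
  have nU : \forall z \near q, U z by exact: open_nbhs_nbhs.
  by apply: filterS nU => z /dF.
have nearmin : \forall z \near q, F q <= F z.
  by apply: filterS nearK => z Kz; apply: minF; exact/mem_set.
(* In the direction [b q] the first-order condition says exactly that the drift term of [F] vanishes
   at [q]. *)
have grad0 := (second_derivative_test (b q) nearF dGF nearmin).1.
pose HF := \matrix_(i, j) 'D_(e_ i) (GF j) q.
have hess : 0 <= \tr (a q *m HF).
  apply: mxtrace_posdef_ge0; first exact: pa.
  move=> v; rewrite quadE; have [_] := second_derivative_test v nearF dGF nearmin.
  move=> h; apply: le_trans h _; rewrite le_eqVlt; apply/orP; left; apply/eqP.
  by apply: eq_bigr => i _; apply: eq_bigr => j _; rewrite !mxE.
pose E := gaussian al y q.
have E0 : 0 < E by exact: expR_gt0.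
have HFE : HF = \matrix_(i, j) 'D_(e_ i) (G j) q -
   (ep * E) *: (4 * al ^+ 2 *: ((q - y)^T *m (q - y)) - (2 * al)%:M).
  apply/matrixP => i j; rewrite !mxE big_ord1 !mxE.
  have -> : GF j = G j - (ep *: gaussian_grad al y j) by [].
  rewrite deriveB; [|exact/diff_derivable/dG|exact/diff_derivable].
  rewrite deriveZ; last exact/diff_derivable/differentiable_gaussian_grad.
  rewrite derive_gaussian_grad /GRing.scale /= -/E; congr (_ - _).
  by case: (i == j); rewrite ?mulr1n ?mulr0n; ring.
have trE : \tr (a q *m ((q - y)^T *m (q - y))) = quad (a q) (q - y).
  by rewrite mulmxA mxtrace_mulC mxtrace_1x1 mulmxA.
have := hess; rewrite HFE mulmxBr -scalemxAr mulmxBr -scalemxAr.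
move: trE; set dd := (_^T *m _) => trE.
rewrite mul_mx_scalar !(linearB, linearZ) /= trE leNgt.
have := Lf q Uq; set tG := \tr (a q *m _); set bG := \sum_j _.
set A0 := quad _ _; set tA := \tr _ => LfG /negP[].
have bE : bG = ep * E * (- (2 * al) * \sum_j b q 0 j * (q 0 j - y 0 j)).
  have : \sum_j b q 0 j * GF j q = bG -
      ep * E * (- (2 * al) * \sum_j b q 0 j * (q 0 j - y 0 j)).
    rewrite !mulr_sumr -sumrB; apply: eq_bigr => j _.
    by rewrite /GF /gaussian_grad -/E; ring.
  by rewrite grad0 => /esym/eqP; rewrite subr_eq0 => /eqP.
have hA : mu <= A0 by apply: minA; exact/mem_set.
have hB : tA + \sum_j b q 0 j * (q 0 j - y 0 j) <= C by apply: maxB; exact/mem_set.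
set B := \sum_j _ in bE hB.
rewrite /GRing.scale /=.
have key : tA + B < 2 * al * A0.
  apply: le_lt_trans hB _; apply: lt_le_trans alC _.
  by rewrite ler_pM2l // mulr_gt0.
have pos : 0 < ep * E * (2 * al) * (2 * al * A0 - (tA + B)).
  by rewrite mulr_gt0 ?subr_gt0 // mulr_gt0 // mulr_gt0.
rewrite bE in LfG.
apply: le_lt_trans (_ : _ <= - (ep * E * (2 * al) * (2 * al * A0 - (tA + B)))) _.
  rewrite [leLHS](_ : _ = (tG + ep * E * (- (2 * al) * B)) -
    (ep * E * (2 * al) * (2 * al * A0 - (tA + B)))); last by ring.
  by rewrite gerDr.
by rewrite oppr_lt0.
Unshelve. all: by end_near. Qed.

End StrongMinimumPrinciple.

(** * Hypersurfaces in a chart *)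

Lemma for_continuous_det (R : realType) (T : topologicalType) n
    (A : T -> 'M[R]_n) (x : T) :
  (forall i j, {for x, continuous (fun z => A z i j)}) ->
  {for x, continuous (fun z => \det (A z))}.
Proof.
move=> cA; rewrite /determinant; apply: for_continuous_sum => s.
apply: continuousM; first exact: cst_continuous.
by apply: for_continuous_prod => i; exact: cA.
Qed.

(* Continuity in the entries is read off this formula, whereas [invmx] branches
   on invertibility. *)
Definition cramer_inv (R : realType) n (A : 'M[R]_n) := (\det A)^-1 *: \adj A.

Lemma cramer_invE (R : realType) n (A : 'M[R]_n) :
  A \in unitmx -> cramer_inv A = invmx A.
Proof. by move=> uA; rewrite /invmx uA. Qed.

Lemma for_continuous_cramer_inv (R : realType) (T : topologicalType) n
    (A : T -> 'M[R]_n) (x : T) i j : \det (A x) != 0 ->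
  (forall i j, {for x, continuous (fun z => A z i j)}) ->
  {for x, continuous (fun z => cramer_inv (A z) i j)}.
Proof.
move=> dA cA.
have -> : (fun z => cramer_inv (A z) i j) =
    fun z => (\det (A z))^-1 * ((-1) ^+ (j + i) * \det (row' j (col' i (A z)))).
  by apply/funext => z; rewrite !mxE.
apply: continuousM; first by apply: continuousV => //; exact: for_continuous_det.
apply: continuousM; first exact: cst_continuous.
apply: for_continuous_det => i' j'.
have -> : (fun z => row' j (col' i (A z)) i' j') =
    fun z => A z (lift j i') (lift i j') by apply/funext => z; rewrite !mxE.
exact: cA.
Qed.

Section MinkowskiDerivative.
Context {R : realType} {m n : nat}.
Implicit Types (P Q : 'rV[R]_m -> 'rV[R]_n.+2) (z v : 'rV[R]_m).

Lemma differentiable_entry P z i : differentiable P z ->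
  differentiable (fun z => P z 0 i) z.
Proof.
move=> dP; have dc : differentiable (fun w : 'rV[R]_n.+2 => w 0 i) (P z).
  exact: differentiable_coord.
exact: (differentiable_comp dP dc).
Qed.

Lemma is_derive_entry P z v i : differentiable P z ->
  is_derive z v (fun z => P z 0 i) ('D_v P z 0 i).
Proof.
move=> dP; apply: DeriveDef.
  exact/diff_derivable/differentiable_entry.
by rewrite derive_mx ?mxE //; exact: diff_derivable.
Qed.

Lemma mink_fctE P Q : (fun z => mink (P z) (Q z)) =
  - ((fun z => P z 0 0) * (fun z => Q z 0 0)) +
  \sum_(i < n.+1) ((fun z => P z 0 (lift ord0 i)) * (fun z => Q z 0 (lift ord0 i))).
Proof. by apply/funext => z; rewrite /mink [RHS]/GRing.add /= fct_sumE. Qed.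

Lemma differentiable_mink P Q z : differentiable P z -> differentiable Q z ->
  differentiable (fun z => mink (P z) (Q z)) z.
Proof.
move=> dP dQ; rewrite mink_fctE; apply: differentiableD.
  by apply: differentiableN; apply: differentiableM; exact: differentiable_entry.
apply: differentiable_sum => i.
by apply: differentiableM; exact: differentiable_entry.
Qed.

Lemma derive_mink P Q z v : differentiable P z -> differentiable Q z ->
  'D_v (fun z => mink (P z) (Q z)) z =
  mink ('D_v P z) (Q z) + mink (P z) ('D_v Q z).
Proof.
move=> dP dQ; rewrite mink_fctE.
have dM i : is_derive z v ((fun z => P z 0 i) * (fun z => Q z 0 i))
    ('D_v P z 0 i * Q z 0 i + P z 0 i * 'D_v Q z 0 i).
  have dp := is_derive_entry v i dP; have dq := is_derive_entry v i dQ.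
  by apply: is_derive_eq; rewrite /GRing.scale /= addrC [X in X + _]mulrC.
have dS := is_derive_sum (fun i : 'I_n.+1 => dM (lift ord0 i)).
have dD := is_deriveD (is_deriveN (dM 0)) dS.
rewrite (@derive_val _ _ _ _ _ _ _ dD) big_split /= /mink; ring.
Qed.

End MinkowskiDerivative.

(** * The Gauss formula in a chart *)

Section ChartGeometry.
Context {R : realType} {n : nat}.
Variables (U : set 'rV[R]_n) (Y N : 'rV[R]_n -> 'rV[R]_n.+2).
Hypothesis oU : open U.
Hypothesis smoothY : smooth_on U Y.
Hypothesis smoothN : smooth_on U N.
Hypothesis hypY : forall z, U z -> hyperbolic_space R n (Y z).
Hypothesis NY : forall z, U z -> mink (N z) (Y z) = 0.
Hypothesis NN : forall z, U z -> mink (N z) (N z) = 1.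
Hypothesis NT : forall z v, U z -> mink (N z) ('D_v Y z) = 0.
Hypothesis immY : forall z, U z -> row_free (jacobian Y z).
Local Notation e_ j := (delta_mx 0 j : 'rV[R]_n).

Let dY z : U z -> differentiable Y z.
Proof. by move=> Uz; exact: (smoothY [::] Uz). Qed.

Let dDY z v : U z -> differentiable ('D_v Y) z.
Proof. by move=> Uz; exact: (smoothY [:: v] Uz). Qed.

Let dN z : U z -> differentiable N z.
Proof. by move=> Uz; exact: (smoothN [::] Uz). Qed.

Definition chart_metric z : 'M[R]_n :=
  \matrix_(i, j) mink ('D_(e_ i) Y z) ('D_(e_ j) Y z).
(** The flat derivative of [N] suffices: projecting it to the hyperboloid adds a multiple of [Y],
    which is orthogonal to the derivatives of [Y]. *)
Definition chart_second z : 'M[R]_n :=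
  \matrix_(i, j) mink ('D_(e_ i) N z) ('D_(e_ j) Y z).
Local Notation g := chart_metric.
Local Notation h := chart_second.

Lemma derive_eq_on (f : 'rV[R]_n -> R) (c : R) z v : U z ->
  (forall z, U z -> f z = c) -> 'D_v f z = 0.
Proof.
move=> Uz fc; rewrite -(derive_cst c z v); apply: near_eq_derive.
have nU : \forall z \near z, U z by exact: open_nbhs_nbhs.
by apply: filterS nU => w /fc.
Qed.

Lemma mink_chart_tangent z v : U z -> mink (Y z) ('D_v Y z) = 0.
Proof.
move=> Uz; have := @derive_eq_on (fun z => mink (Y z) (Y z)) (-1) z v Uz.
rewrite derive_mink; [|exact: dY..].
rewrite (minkC ('D_v Y z)) => /(_ _) H.
have : mink (Y z) ('D_v Y z) + mink (Y z) ('D_v Y z) = 0.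
  by apply: H => w /hypY [].
lra.
Qed.

(** Differentiate the orthogonality of [Y] to its derivatives; [mink_normal_hessian] does the same
    with [N]. Together they are the normal part of the Gauss formula. *)
Lemma mink_chart_hessian z i j : U z ->
  mink (Y z) ('D_(e_ i) ('D_(e_ j) Y) z) = - g z i j.
Proof.
move=> Uz.
have := @derive_eq_on (fun z => mink (Y z) ('D_(e_ j) Y z)) 0 z (e_ i) Uz.
rewrite derive_mink; [|exact: dY|exact: dDY] => H.
rewrite mxE; apply/eqP; rewrite -addr_eq0 addrC; apply/eqP; apply: H.
by move=> w; exact: mink_chart_tangent.
Qed.

Lemma mink_normal_hessian z i j : U z ->
  mink (N z) ('D_(e_ i) ('D_(e_ j) Y) z) = - h z i j.
Proof.
move=> Uz.
have := @derive_eq_on (fun z => mink (N z) ('D_(e_ j) Y z)) 0 z (e_ i) Uz.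
rewrite derive_mink; [|exact: dN|exact: dDY] => H.
rewrite mxE; apply/eqP; rewrite -addr_eq0 addrC; apply/eqP; apply: H.
by move=> w; exact: NT.
Qed.

Lemma derive_row_sum z v : U z -> 'D_v Y z = \sum_i v 0 i *: 'D_(e_ i) Y z.
Proof.
move=> Uz; rewrite deriveE; last exact: dY.
rewrite {1}(row_sum_delta v) linear_sum.
by apply: eq_bigr => i _; rewrite linearZ deriveE //; exact: dY.
Qed.

Lemma derive_eq0_on z v : U z -> 'D_v Y z = 0 -> v = 0.
Proof.
move=> Uz; rewrite deriveEjacobian; last exact: dY.
by move=> vJ; apply: (row_free_inj (immY Uz)); rewrite mul0mx.
Qed.

Lemma quad_chart_metric z v : U z -> quad (g z) v = mink ('D_v Y z) ('D_v Y z).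
Proof.
move=> Uz; rewrite quadE (derive_row_sum v Uz) mink_suml; apply: eq_bigr => i _.
rewrite mink_sumr; apply: eq_bigr => j _.
by rewrite mxE minkZl minkZr mulrA.
Qed.

Lemma posdef_chart_metric z : U z -> posdef (g z).
Proof.
move=> Uz; split; first by apply/matrixP => i j; rewrite !mxE minkC.
move=> v v0; rewrite quad_chart_metric //.
have [ge0 eq0] := mink_orthogonal_timelike (hypY Uz).1 (mink_chart_tangent v Uz).
rewrite lt_neqAle ge0 andbT eq_sym; apply: contra_neq v0 => /eq0.
exact: derive_eq0_on.
Qed.

(** Coordinates of the tangential part of [p] in the chart frame: the products with the frame times
    the inverse Gram matrix. *)
Definition tangent_coef (p : 'rV[R]_n.+2) z : 'rV[R]_n :=
  (\row_j mink p ('D_(e_ j) Y z)) *m invmx (g z).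

(** The difference of the two sides is orthogonal to [Y], to [N] and to every frame vector, and
    these [n.+2] vectors span the ambient space. *)
Lemma frame_decomposition p z : U z ->
  p = - mink p (Y z) *: Y z + mink p (N z) *: N z +
      \sum_j tangent_coef p z 0 j *: 'D_(e_ j) Y z.
Proof.
move=> Uz; apply/eqP; rewrite -subr_eq0; apply/eqP.
set T := \sum_j _; set w := _ - _.
have [YY _] := hypY Uz.
have TY : mink T (Y z) = 0.
  rewrite mink_suml big1 // => j _.
  by rewrite minkZl minkC mink_chart_tangent // mulr0.
have TN : mink T (N z) = 0.
  by rewrite mink_suml big1 // => j _; rewrite minkZl minkC NT // mulr0.
have TD i : mink T ('D_(e_ i) Y z) = mink p ('D_(e_ i) Y z).
  have : tangent_coef p z *m g z = \row_j mink p ('D_(e_ j) Y z).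
    by rewrite mulmxKV // posdef_unitmx //; exact: posdef_chart_metric.
  move=> /rowP /(_ i); rewrite [in RHS]mxE => <-.
  by rewrite mink_suml mxE; apply: eq_bigr => j _; rewrite minkZl [g z j i]mxE.
have wY : mink w (Y z) = 0 by rewrite /w !minkE YY NY // TY; ring.
have wN : mink w (N z) = 0.
  by rewrite /w !minkE NN // TN (minkC (Y z)) NY //; ring.
have wD i : mink w ('D_(e_ i) Y z) = 0.
  by rewrite /w !minkE TD mink_chart_tangent // NT //; ring.
pose J : 'M[R]_(n, n.+2) := jacobian Y z.
(* Invertible because [Y], [N] and the tangent vectors are mutually orthogonal and the immersion has
   full rank. *)
pose B : 'M[R]_(1 + (1 + n)) := col_mx (Y z) (col_mx (N z) J).
have rJ (v : 'rV[R]_n) : v *m J = 'D_v Y z.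
  by rewrite deriveEjacobian //; exact: dY.
have Bunit : B \in unitmx.
  rewrite -row_free_unit -kermx_eq0; apply/rowV0P => v /sub_kermxP.
  pose a := lsubmx (v : 'rV_(1 + (1 + n))).
  pose b := lsubmx (rsubmx (v : 'rV_(1 + (1 + n)))).
  pose c := rsubmx (rsubmx (v : 'rV_(1 + (1 + n)))).
  have vE : v = row_mx a (row_mx b c) by rewrite !hsubmxK.
  rewrite vE /B !mul_row_col rJ [a]mx11_scalar [b]mx11_scalar !mul_scalar_mx => v0.
  have a0 : a 0 0 = 0.
    have := mink0l (Y z); rewrite -v0 !minkDl !minkZl YY NY //.
    by rewrite minkC mink_chart_tangent //; lra.
  have b0 : b 0 0 = 0.
    have := mink0l (N z); rewrite -v0 !minkDl !minkZl NN //.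
    by rewrite (minkC (Y z)) NY // minkC NT //; lra.
  move: v0; rewrite a0 b0 !scale0r !add0r => /(derive_eq0_on Uz) ->.
  by rewrite raddf0 !row_mx0.
have wB p' : mink w (p' *m B) = 0.
  pose a := lsubmx (p' : 'rV_(1 + (1 + n))).
  pose b := lsubmx (rsubmx (p' : 'rV_(1 + (1 + n)))).
  pose c := rsubmx (rsubmx (p' : 'rV_(1 + (1 + n)))).
  have -> : p' = row_mx a (row_mx b c) by rewrite !hsubmxK.
  rewrite /B !mul_row_col rJ [a]mx11_scalar [b]mx11_scalar !mul_scalar_mx.
  rewrite !minkDr !minkZr wY wN !mulr0 !add0r (derive_row_sum c Uz) mink_sumr.
  by apply: big1 => j _; rewrite minkZr wD mulr0.
apply: mink_nondegenerate => v.
by rewrite minkC -(mulmxKV Bunit v) wB.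
Qed.

(** The first two terms are the Laplacian of [mink p Y]. The last sum carries the Christoffel
    symbols and is of first order, [tangent_coef] being linear in the partial derivatives of
    [mink p Y]. *)
Lemma metric_trace_hessian p z : U z ->
  \tr (invmx (g z) *m \matrix_(i, j) mink p ('D_(e_ i) ('D_(e_ j) Y) z)) =
  n%:R * mink p (Y z) - mink p (N z) * \tr (h z *m invmx (g z)) +
  \sum_j tangent_coef p z 0 j *
    \tr (invmx (g z) *m
      \matrix_(k, l) mink ('D_(e_ j) Y z) ('D_(e_ k) ('D_(e_ l) Y) z)).
Proof.
move=> Uz; have ug := posdef_unitmx (posdef_chart_metric Uz).
have -> : \matrix_(i, j) mink p ('D_(e_ i) ('D_(e_ j) Y) z) =
  mink p (Y z) *: g z - mink p (N z) *: h z + \sum_j tangent_coef p z 0 j *: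
    \matrix_(k, l) mink ('D_(e_ j) Y z) ('D_(e_ k) ('D_(e_ l) Y) z).
  apply/matrixP => i j; rewrite !(mxE, summxE).
  rewrite {1}(frame_decomposition p Uz) !minkDl !minkZl mink_suml.
  rewrite mink_chart_hessian // mink_normal_hessian // !mxE mulrNN mulrN.
  by congr (_ + _); apply: eq_bigr => k _; rewrite minkZl !mxE.
rewrite mulmxDr mulmxBr -!scalemxAr mulVmx // mulmx_sumr.
rewrite mxtraceD raddfB /= !mxtraceZ mxtrace1 mxtrace_mulC [_ * n%:R]mulrC.
congr (_ + _); rewrite raddf_sum /=; apply: eq_bigr => j _.
by rewrite -scalemxAr mxtraceZ.
Qed.

Lemma differentiable_mink_cst p z : U z ->
  differentiable (fun z => mink p (Y z)) z /\
  forall v, 'D_v (fun z => mink p (Y z)) z = mink p ('D_v Y z).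
Proof.
move=> Uz; have dc : differentiable (fun _ : 'rV[R]_n => p) z by [].
split; first exact: differentiable_mink dc (dY Uz).
by move=> v; rewrite (derive_mink v dc (dY Uz)) derive_cst mink0l add0r.
Qed.

Lemma differentiable_mink_cst_derive p w z : U z ->
  differentiable (fun z => mink p ('D_w Y z)) z /\
  forall v, 'D_v (fun z => mink p ('D_w Y z)) z = mink p ('D_v ('D_w Y) z).
Proof.
move=> Uz; have dc : differentiable (fun _ : 'rV[R]_n => p) z by [].
split; first exact: differentiable_mink dc (dDY w Uz).
by move=> v; rewrite (derive_mink v dc (dDY w Uz)) derive_cst mink0l add0r.
Qed.

Lemma mink_min_test p z0 v : U z0 ->
  (forall z, U z -> mink p (Y z0) <= mink p (Y z)) ->
  mink p ('D_v Y z0) = 0 /\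
  0 <= quad (\matrix_(i, j) mink p ('D_(e_ i) ('D_(e_ j) Y) z0)) v.
Proof.
move=> Uz0 min0.
have nU : \forall z \near z0, U z by exact: open_nbhs_nbhs.
pose G (j : 'I_n) z := mink p ('D_(e_ j) Y z).
have [] := @second_derivative_test R n (fun z => mink p (Y z)) G z0 v.
- apply: filterS nU => z Uz; have [d D] := differentiable_mink_cst p Uz.
  by split => // j; exact: D.
- by move=> j; have [] := differentiable_mink_cst_derive p (e_ j) Uz0.
- by apply: filterS nU => z /min0.
move=> g0 hess; split.
  rewrite -[RHS]g0 (derive_row_sum v Uz0) mink_sumr.
  by apply: eq_bigr => j _; rewrite minkZr.
rewrite quadE; apply: le_trans hess _; rewrite le_eqVlt; apply/orP; left; apply/eqP.
apply: eq_bigr => i _; apply: eq_bigr => j _; rewrite mxE.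
by have [_ ->] := differentiable_mink_cst_derive p (e_ j) Uz0.
Qed.

(** The drift [b] is chosen to cancel the Christoffel terms, so that the elliptic operator applied
    to [mink p Y] is the left side of the hypothesis. *)
Lemma chart_strong_minimum p z0 : U z0 ->
  (forall z, U z ->
    n%:R * mink p (Y z) - mink p (N z) * \tr (h z *m invmx (g z)) <= 0) ->
  (forall z, U z -> mink p (Y z0) <= mink p (Y z)) ->
  \forall z \near z0, mink p (Y z) = mink p (Y z0).
Proof.
move=> Uz0 super min0.
pose G (j : 'I_n) z := mink p ('D_(e_ j) Y z).
pose c z := cramer_inv (g z).
have cE z : U z -> c z = invmx (g z).
  by move=> Uz; apply: cramer_invE; apply: posdef_unitmx; exact: posdef_chart_metric.
pose Gam z (m : 'I_n) :=
  \matrix_(k, l) mink ('D_(e_ m) Y z) ('D_(e_ k) ('D_(e_ l) Y) z).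
pose b z : 'rV[R]_n := - \row_l \sum_m c z l m * \tr (c z *m Gam z m).
have dG z v : U z -> differentiable ('D_v Y) z by exact: dDY.
have cc z i j : U z -> {for z, continuous (fun z => c z i j)}.
  move=> Uz; apply: for_continuous_cramer_inv => [|k l].
    by rewrite -unitfE -unitmxE; apply: posdef_unitmx; exact: posdef_chart_metric.
  have -> : (fun z => g z k l) =
      fun z => mink ('D_(e_ k) Y z) ('D_(e_ l) Y z).
    by apply/funext => w; rewrite mxE.
  by apply/differentiable_continuous/differentiable_mink; exact: dDY.
have cGam z m k l : U z -> {for z, continuous (fun z => Gam z m k l)}.
  move=> Uz.
  have -> : (fun z => Gam z m k l) =
      fun z => mink ('D_(e_ m) Y z) ('D_(e_ k) ('D_(e_ l) Y) z).
    by apply/funext => w; rewrite mxE.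
  apply/differentiable_continuous/differentiable_mink; first exact: dDY.
  exact: (smoothY [:: e_ k; e_ l] Uz).
apply: (@strong_minimum_principle R n U (fun z => mink p (Y z)) G c b z0) => //.
- move=> z Uz; have [d D] := differentiable_mink_cst p Uz.
  by split => // j; exact: D.
- by move=> z j Uz; have [] := differentiable_mink_cst_derive p (e_ j) Uz.
- by move=> z Uz; rewrite cE //; apply/posdef_invmx/posdef_chart_metric.
- move=> z j Uz; have -> : (fun z => b z 0 j) =
      fun z => - \sum_m c z j m * \sum_k \sum_l c z k l * Gam z m l k.
    apply/funext => w; rewrite !mxE; congr (- _); apply: eq_bigr => m _.
    by congr (_ * _); apply: eq_bigr => k _; rewrite mxE.
  apply: continuousN; apply: for_continuous_sum => m.
  apply: continuousM; first exact: cc.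
  apply: for_continuous_sum => k; apply: for_continuous_sum => l.
  by apply: continuousM; [exact: cc | exact: cGam].
move=> z Uz.
have -> : (\matrix_(i, j) 'D_(e_ i) (G j) z) =
    \matrix_(i, j) mink p ('D_(e_ i) ('D_(e_ j) Y) z).
  apply/matrixP => i j; rewrite !mxE.
  by have [_ ->] := differentiable_mink_cst_derive p (e_ j) Uz.
rewrite [c z in X in X + _]cE // metric_trace_hessian //.
apply: le_trans (super z Uz); rewrite -addrA gerDl.
rewrite le_eqVlt; apply/orP; left; apply/eqP.
rewrite /b /tangent_coef -cE //.
under eq_bigr do rewrite mxE mulr_suml.
rewrite exchange_big -big_split big1 //= => j _.
rewrite !mxE mulNr mulr_suml -sumrB big1 // => m _.
by rewrite mxE -/(Gam z m) /G; ring.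
Qed.

End ChartGeometry.

(** * Closed hypersurfaces *)

Section Curvatures.
Context {R : realType}.

Lemma mxtrace_char_poly n (B : 'M[R]_n) (l : 'rV[R]_n) : (0 < n)%N ->
  char_poly B = \prod_(i < n) ('X - (l 0 i)%:P) -> \tr B = \sum_i l 0 i.
Proof.
move=> n0 cp; apply: oppr_inj; rewrite -char_poly_trace // cp.
have sz : size [seq l 0 i | i <- index_enum 'I_n] = n.
  by rewrite size_map [index_enum _]unlock -enumT size_enum_ord.
have := @coefPn_prod_XsubC R [seq l 0 i | i <- index_enum 'I_n].
by rewrite sz !big_map => ->; rewrite // -lt0n.
Qed.

(** The factorization makes [l 0 i] an eigenvalue; for a left eigenvector [v] it is the Rayleigh
    quotient of [h] with respect to [g]. *)
Lemma char_poly_pencil_ge n (g h : 'M[R]_n) (l : 'rV[R]_n) (s t : R) :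
  posdef g -> 0 < s -> (forall v, t * quad g v <= s * quad h v) ->
  char_poly (h *m invmx g) = \prod_(i < n) ('X - (l 0 i)%:P) ->
  forall i, t / s <= l 0 i.
Proof.
move=> pg s0 H cp i.
have : eigenvalue (h *m invmx g) (l 0 i).
  rewrite eigenvalue_root_char cp /root horner_prod (bigD1 i) //=.
  by rewrite hornerXsubC subrr mul0r.
case/eigenvalueP => v vh v0.
have ug := posdef_unitmx pg.
have vhE : v *m h = l 0 i *: (v *m g).
  by rewrite scalemxAl -vh -!mulmxA mulVmx // mulmx1.
have q : quad h v = l 0 i * quad g v.
  by rewrite /quad vhE -scalemxAl mxE.
have := H v; rewrite q mulrA ler_pM2r; last by case: pg => _; apply.
by rewrite ler_pdivrMr // mulrC.
Qed.

End Curvatures.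

(** * From charts to the whole hypersurface *)

Section ManifoldFacts.
Context {R : realType} {n : nat} {M : topologicalType}.
Variables (A : set (chart R n M)) (X N : M -> 'rV[R]_n.+2).
Hypothesis SigmaX : closed_hypersurface A X.

Lemma atlas_chart c : A c -> is_chart c.
Proof. by case: SigmaX => _ [h _ _] _ _ /h. Qed.

Lemma atlas_cover p : exists c, [/\ A c, chart_dom c p,
  chart_codom c (chart_map c p) & chart_inv c (chart_map c p) = p].
Proof.
case: SigmaX => _ [h cover _] _ _; have [c Ac cp] := cover p.
have [_ _ inv _ _] := h c Ac; exists c; split => //; first by exists p.
exact: inv.
Qed.

Lemma open_chart_codom c : A c -> open (chart_codom c).
Proof. by move=> /atlas_chart[]. Qed.

Lemma smooth_chart c : A c -> smooth_on (chart_codom c) (X \o chart_inv c).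
Proof. by move=> Ac; case: SigmaX => _ _ _ [sm _]; exact: sm. Qed.

Lemma chart_row_free c z : A c -> chart_codom c z ->
  row_free (jacobian (X \o chart_inv c) z).
Proof. by move=> Ac cz; case: SigmaX => _ _ _ [_]; apply. Qed.

Lemma hypersurface_hyperbolic p : hyperbolic_space R n (X p).
Proof. by case: SigmaX. Qed.

Lemma near_chart c p (P : set 'rV[R]_n) : A c -> chart_dom c p ->
  (\forall z \near chart_map c p, P z) ->
  \forall q \near p, chart_dom c q /\ P (chart_map c q).
Proof.
move=> Ac cp Pz; have [od _ _ cm _] := atlas_chart Ac.
have dn : \forall q \near p, chart_dom c q by exact: open_nbhs_nbhs.
rewrite continuous_open_subspace // in cm.
have : {for p, continuous (chart_map c)} by apply: cm; exact/mem_set.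
by move=> /(_ _ Pz) mn; exact: filterI.
Qed.

Lemma hypersurface_continuous : continuous X.
Proof.
move=> p; have [c [Ac cp cz inv]] := atlas_cover p.
have [_ _ invc _ _] := atlas_chart Ac.
have cY : {for chart_map c p, continuous (X \o chart_inv c)}.
  exact: differentiable_continuous (smooth_chart Ac [::] cz).
move=> S XS; have /= := cY S; rewrite inv => /(_ XS) nz.
have := near_chart Ac cp nz; apply: filterS => q [dq].
by rewrite /= invc.
Qed.

Lemma continuous_mink_cst o : continuous (fun p => mink o (X p)).
Proof.
move=> p; rewrite /mink.
have cC i : {for p, continuous (fun p => X p 0 i)}.
  exact: (continuous_comp (@hypersurface_continuous p)
            (@coord_continuous _ _ _ 0 i (X p))).
have cM i : {for p, continuous (fun p => o 0 i * X p 0 i)}.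
  by apply: continuousM; [exact: cst_continuous | exact: cC].
have cS := for_continuous_sum (P := xpredT) (fun i : 'I_n.+1 => cM (lift ord0 i)).
exact: (continuousD (continuousN (cM 0)) cS).
Qed.

Lemma mink_min_exists (o : 'rV[R]_n.+2) : [set: M] !=set0 ->
  exists p, forall q, mink o (X p) <= mink o (X q).
Proof.
move=> M0; case: SigmaX => [[_ cM _] _ _ _].
have cw : {within [set: M], continuous (fun p => mink o (X p))}.
  exact: continuous_subspaceT (@continuous_mink_cst o).
have [p _ pmin] := compact_EVT_min M0 cM cw.
by exists p => q; apply: pmin; exact/mem_set.
Qed.

Hypothesis normalN : forall p, mink (N p) (X p) = 0 /\ mink (N p) (N p) = 1.
Hypothesis smoothN : smooth_map A N.
Hypothesis tangentN : forall c z v, A c -> chart_codom c z ->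
  mink (N (chart_inv c z)) ('D_v (X \o chart_inv c) z) = 0.

Lemma second_formE c z : A c -> chart_codom c z ->
  second_form c X N z = chart_second (X \o chart_inv c) (N \o chart_inv c) z.
Proof.
move=> Ac cz; apply/matrixP => i j; rewrite !mxE /covariant_derivative.
rewrite /tangent_proj minkDl minkZl.
have := @mink_chart_tangent R n (chart_codom c) (X \o chart_inv c)
  (open_chart_codom Ac) (smooth_chart Ac) _ z (coord_vec j) cz.
by move=> -> //=; [rewrite mulr0 addr0 | move=> w _; exact: hypersurface_hyperbolic].
Qed.

Lemma first_formE c z : first_form c X z = chart_metric (X \o chart_inv c) z.
Proof. by []. Qed.

Lemma posdef_first_form c z : A c -> chart_codom c z -> posdef (first_form c X z).
Proof.
move=> Ac cz; apply: (posdef_chart_metric (U := chart_codom c)) => //.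
- exact: open_chart_codom.
- exact: smooth_chart.
- by move=> w _; exact: hypersurface_hyperbolic.
- by move=> w; exact: chart_row_free.
Qed.

(** The set where the minimum is attained is nonempty by compactness, closed by continuity and open
    by the minimum principle in a chart; connectedness does the rest. *)
Lemma mink_constant_of_superharmonic o : [set: M] !=set0 ->
  (forall c z, A c -> chart_codom c z ->
    n%:R * mink o (X (chart_inv c z)) - mink o (N (chart_inv c z)) *
      \tr (second_form c X N z *m invmx (first_form c X z)) <= 0) ->
  forall p q, mink o (X p) = mink o (X q).
Proof.
move=> M0 super; have [p0 min0] := mink_min_exists o M0.
suff all0 p : mink o (X p) = mink o (X p0) by move=> p q; rewrite !all0.
case: SigmaX => [[_ _ connM] _ _ _].
pose B := [set p | mink o (X p) = mink o (X p0)].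
suff BT : B = [set: M] by have : [set: M] p by []; rewrite -BT.
have clB : closed B.
  have -> : B = (fun p => mink o (X p)) @^-1` [set x | x = mink o (X p0)] by [].
  apply: (continuous_closedP (fun p => mink o (X p))).1; last exact: closed_eq.
  exact: continuous_mink_cst.
have opB : open B.
  rewrite openE => q Bq; rewrite /interior.
  have [c [Ac cq cz inv]] := atlas_cover q.
  have [_ _ invc _ _] := atlas_chart Ac.
  have : \forall z \near chart_map c q, mink o ((X \o chart_inv c) z) =
      mink o ((X \o chart_inv c) (chart_map c q)).
    apply: (@chart_strong_minimum R n (chart_codom c) _ (N \o chart_inv c)) => //.
    - exact: open_chart_codom.
    - exact: smooth_chart.
    - exact: smoothN.
    - by move=> w _; exact: hypersurface_hyperbolic.
    - by move=> w _; exact: (normalN _).1.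
    - by move=> w _; exact: (normalN _).2.
    - by move=> w v; exact: tangentN.
    - by move=> w; exact: chart_row_free.
    - by move=> w cw; rewrite -second_formE // -first_formE; exact: super.
    - by move=> w _ /=; rewrite inv Bq.
  move=> /(near_chart Ac cq); apply: filterS => w [dw /=].
  by rewrite invc // inv Bq.
apply: connM; first by exists p0.
- by exists B => //; rewrite setTI.
- by exists B => //; rewrite setTI.
Qed.

Lemma mink_min_tangent o p : (forall q, mink o (X p) <= mink o (X q)) ->
  forall c z v, A c -> chart_codom c z -> chart_inv c z = p ->
  mink o ('D_v (X \o chart_inv c) z) = 0 /\
  0 <= quad (\matrix_(i, j)
    mink o ('D_(coord_vec i) ('D_(coord_vec j) (X \o chart_inv c)) z)) v.
Proof.
move=> pmin c z v Ac cz inv.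
apply: (@mink_min_test R n (chart_codom c)) => //.
- exact: open_chart_codom.
- exact: smooth_chart.
- by move=> w _ /=; rewrite inv.
Qed.

(** At a critical point of [mink o X] the vector [o] lies in the plane of [X] and [N], so this
    expresses the second derivatives through the two fundamental forms. *)
Lemma mink_normal_plane_hessian c z s t i j : A c -> chart_codom c z ->
  mink (s *: X (chart_inv c z) + t *: N (chart_inv c z))
    ('D_(coord_vec i) ('D_(coord_vec j) (X \o chart_inv c)) z) =
  - (s * first_form c X z i j + t * second_form c X N z i j).
Proof.
move=> Ac cz; rewrite second_formE // first_formE minkDl !minkZl.
have := @mink_chart_hessian R n (chart_codom c) (X \o chart_inv c)
  (open_chart_codom Ac) (smooth_chart Ac) _ z i j cz.
have := @mink_normal_hessian R n (chart_codom c) (X \o chart_inv c)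
  (N \o chart_inv c) (open_chart_codom Ac) (smooth_chart Ac) (smoothN Ac) _ z i j cz.
move=> /= -> => [-> |w v cw]; last exact: tangentN.
  by rewrite !mulrN opprD.
by move=> w _; exact: hypersurface_hyperbolic.
Qed.

Lemma hypersurface_nonconstant : (0 < n)%N -> forall p, exists q, X q <> X p.
Proof.
move=> n0 p; apply: contrapT => H.
have Xc q : X q = X p by apply: contrapT => h; apply: H; exists q.
have [c [Ac cp cz _]] := atlas_cover p.
have /eqP : (delta_mx 0 (Ordinal n0) : 'rV[R]_n) = 0.
  apply: (derive_eq0_on (smooth_chart Ac) _ cz).
    by move=> w; exact: chart_row_free.
  have -> : X \o chart_inv c = cst (X p) by apply/funext => w; exact: Xc.
  exact: derive_cst.
by apply/negP/eqP => /rowP /(_ (Ordinal n0)); rewrite !mxE !eqxx; apply/eqP/oner_neq0.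
Qed.

(* At a point [x] of the hypersurface closest to a point [c] of the level set,
   [c] is normal to the hypersurface, hence [c = x] or [c] is antipodal to [x]
   on the sphere; in the latter case the hypersurface would be constant. *)
Lemma level_set_sub_range (o : 'rV[R]_n.+2) (m : R) : (0 < n)%N ->
  [set: M] !=set0 -> hyperbolic_space R n o -> (forall p, mink o (X p) = - m) ->
  (forall p, mink o (N p) != 0) ->
  forall y, hyperbolic_space R n y -> mink o y = - m -> range X y.
Proof.
move=> n0 M0 ho Xm oN y hy ym.
(* [mink (- y)] is the hyperbolic cosine of the distance to [y], so [X p] is a closest point. *)
have [p pmin] := mink_min_exists (- y) M0.
have [c [Ac cp cz inv]] := atlas_cover p.
set z := chart_map c p in cz inv.
have omin q : mink o (X p) <= mink o (X q) by rewrite !Xm.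
have frame w : (forall v, mink w ('D_v (X \o chart_inv c) z) = 0) ->
    w = - mink w (X p) *: X p + mink w (N p) *: N p.
  move=> wD.
  have dec : w = - mink w ((X \o chart_inv c) z) *: (X \o chart_inv c) z
      + mink w ((N \o chart_inv c) z) *: (N \o chart_inv c) z
      + \sum_j tangent_coef (X \o chart_inv c) w z 0 j *:
          'D_(delta_mx 0 j) (X \o chart_inv c) z.
    apply: (@frame_decomposition R n (chart_codom c)) => //.
    - exact: open_chart_codom.
    - exact: smooth_chart.
    - by move=> x _; exact: hypersurface_hyperbolic.
    - by move=> x _; exact: (normalN _).1.
    - by move=> x _; exact: (normalN _).2.
    - by move=> x v; exact: tangentN.
    - by move=> x; exact: chart_row_free.
  rewrite {1}dec /= inv big1 ?addr0 // => j _.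
  rewrite /tangent_coef (_ : \row_j _ = 0) ?mul0mx ?mxE ?scale0r //.
  by apply/rowP => k; rewrite !mxE wD.
(* As [mink o X] is constant, every point is a minimum of it, and [o] is normal at [p]. *)
have eo : o = m *: X p + mink o (N p) *: N p.
  rewrite {1}(frame o) ?Xm ?opprK // => v.
  by have [] := mink_min_tangent omin v Ac cz inv.
have ey : y = - mink y (X p) *: X p + mink y (N p) *: N p.
  apply: frame => v; apply: oppr_inj; rewrite -minkNl oppr0.
  by have [] := mink_min_tangent pmin v Ac cz inv.
have [Np NN] := normalN p; have [xx _] := hypersurface_hyperbolic p.
have oNp := oN p.
set x := X p in eo ey Np xx *; set u := mink o (N p) in eo oNp.
have m1 : 0 < m ^+ 2 - 1.
  have : mink o o = -1 by case: ho.
  rewrite {1 2}eo !minkE xx NN (minkC x) Np => e.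
  have -> : m ^+ 2 - 1 = u ^+ 2 by rewrite !expr2; lra.
  by rewrite exprn_even_gt0.
(* Coordinates of [y] in the basis [x], [o] of the normal plane, available because [u != 0]. *)
pose al := - mink y x - m * (mink y (N p) / u).
pose ga := mink y (N p) / u.
have {}ey : y = al *: x + ga *: o.
  rewrite {1}ey [X in _ = _ + ga *: X]eo scalerDr !scalerA addrA -scalerDl.
  rewrite /al /ga divfK //.
  by congr (_ *: _ + _); ring.
have ox : mink o x = - m by exact: Xm.
have oo : mink o o = -1 by case: ho.
have gaE : ga = m * (1 - al).
  move: ym; rewrite ey !minkE ox oo => h; lra.
have : (1 - al) * (1 + al) * (m ^+ 2 - 1) = 0.
  have yy : mink y y = -1 by case: hy.
  move: yy; rewrite {1 2}ey !minkE ox oo xx (minkC x o) ox gaE => h.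
  lra.
move/eqP; rewrite !mulf_eq0 (gt_eqF m1) orbF => /orP[|] /eqP al1.
  exists p => //; rewrite ey gaE al1 mulr0 scale0r addr0.
  have al_1 : al = 1 by move: al1; clearbody al; lra.
  by rewrite al_1 scale1r.
have alN1 : al = -1 by move: al1; clearbody al; lra.
(* Now [y = - x + 2 m o], and minimality at [p] reads [mink x (X q) >= -1], which forces
   [X q = x]. *)
have [q []] := hypersurface_nonconstant n0 p.
have [h1 h2] :=
  hyperbolic_mink_le (hypersurface_hyperbolic p) (hypersurface_hyperbolic q).
have := pmin q; rewrite ey gaE alN1 !minkE ox Xm -/x xx => h.
apply/esym/h2; rewrite -/x in h1 *; lra.
Qed.

End ManifoldFacts.

Theorem theorem1p5 (R : realType) (n : nat) (n_ge1 : (1 <= n)%N)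
    (o : 'rV[R]_n.+2) (o_hyp : hyperbolic_space R n o)
    (M : topologicalType) (A : set (chart R n M))
    (X N : M -> 'rV[R]_n.+2) (kappa : M -> 'rV[R]_n)
    (SigmaX : closed_hypersurface A X)
    (normalN : outward_unit_normal o A X N)
    (curvK : principal_curvatures A X N kappa)
    (a : 'I_n.+1 -> 'I_n.+1 -> M -> R)
    (a_ge0 : forall (i j : 'I_n.+1) (p : M), (i < j)%N -> 0 <= a i j p)
    (a_sum1 : forall p : M,
       \sum_(i < n.+1) \sum_(j < n.+1 | (i < j)%N) a i j p = 1)
    (k : nat)
    (k_max : k = \max_(j < n.+1 |
       `[< exists (i : 'I_n.+1) (p : M), (i < j)%N /\ 0 < a i j p >]) (j : nat))
    (cone : forall p : M, Garding_cone k (shifted kappa p))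
    (equation : exists beta : R, 0 < beta /\ forall p : M,
       \sum_(i < n.+1) \sum_(j < n.+1 | (i < j <= k)%N)
          a i j p *
          (normalized_sigma i (shifted kappa p) /
           normalized_sigma j (shifted kappa p)) `^ (((j - i)%N)%:R^-1)
       = beta * (support_function o X N p /
                 (potential o X p - support_function o X N p))) :
  geodesic_sphere (range X).
Proof.
case: normalN => smoothN nN tN [pm [rmax Npm]].
case: equation => beta [beta0 eqn].
have hX p : hyperbolic_space R n (X p) by exact: hypersurface_hyperbolic SigmaX p.
pose V p : R := - mink o (X p).
pose u p : R := - mink o (N p).
have VE p : potential o X p = V p by rewrite /potential cosh_hdist.
have uE p : support_function o X N p = u p.
  rewrite /support_function sinh_radial_field // minkDl minkNl minkZl.
  by rewrite (minkC (X p)) (nN p).1 mulr0 add0r.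
have uV p : 0 < V p - u p.
  by rewrite subr_gt0; exact: mink_normal_lt (nN p).1 (nN p).2.
have kn : (k <= n)%N.
  by rewrite k_max; apply/bigmax_leqP => j _; rewrite -ltnS.
(* A weight nonzero at some point puts [j] among the indices of which [k] is the maximum. *)
have a0 (i j : 'I_n.+1) p : (i < j)%N -> ~~ (j <= k)%N -> a i j p = 0.
  move=> ij; apply: contraNeq => aij; rewrite k_max.
  apply: (@leq_bigmax_cond _ _ (fun j : 'I_n.+1 => nat_of_ord j)).
  by apply/asboolP; exists i, p; split; rewrite // lt0r aij a_ge0.
have a_sum p : \sum_(i < n.+1) \sum_(j < n.+1 | (i < j <= k)%N) a i j p = 1.
  rewrite -(a_sum1 p); apply: eq_bigr => i _.
  rewrite [RHS](bigID (fun j : 'I_n.+1 => (j <= k)%N)) /= [X in _ + X]big1 ?addr0 //.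
  by move=> j /andP[ij jk]; exact: a0.
(* For [k = 0] the sum of the weights would be empty, yet it is [1]. *)
have k0 : (0 < k)%N.
  rewrite lt0n; apply/eqP => k0; have := a_sum pm.
  rewrite big1 => [/eqP|i _]; first by rewrite eq_sym oner_eq0.
  by apply: big1 => j /andP[ij]; rewrite k0 leqn0 => /eqP j0; rewrite j0 in ij.
pose H1 p := normalized_sigma 1 (shifted kappa p).
have H10 p : 0 < H1 p by exact: Garding_normalized_gt0 kn (cone p) k0.
have lower p : (H1 p)^-1 <= beta * (u p / (V p - u p)).
  rewrite -VE -uE -eqn -[leLHS]mul1r -[X in X * _ <= _](a_sum p) mulr_suml.
  apply: ler_sum => i _.
  rewrite mulr_suml; apply: ler_sum => j ijk; apply: ler_wpM2l.
    by case/andP: ijk => /a_ge0 ->.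
  exact: Garding_quotient_ge kn (cone p) ijk.
have u0 p : 0 < u p.
  have : 0 < beta * (u p / (V p - u p)).
    by apply: lt_le_trans (lower p); rewrite invr_gt0.
  by rewrite pmulr_rgt0 // pmulr_lgt0 // invr_gt0.
have VM p : V p <= V pm.
  rewrite -!VE; apply: ler_cosh (rmax p); exact: hdist_ge0.
(* The normal at [pm] is the radial field, so [u pm] equals [sinh] of the distance and the formula
   for the radial field can be solved for [o]. *)
have oE : o = V pm *: X pm - u pm *: N pm.
  have sr := sinh_radial_field o_hyp (hX pm); rewrite -Npm in sr.
  have us : u pm = sinh (hdist o (X pm)).
    rewrite -uE /support_function -Npm minkZl (nN pm).2 mulr1 //.
  by rewrite us sr -/(V pm) opprB addrC subrK.
have [c [Ac cp cz inv]] := atlas_cover SigmaX pm.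
set z := chart_map c pm in cz inv.
have kge i : (V pm - u pm) / u pm <= shifted kappa pm 0 i.
  have kk : V pm / u pm <= kappa pm 0 i.
    have cpoly := curvK c z Ac cz; rewrite inv in cpoly.
    apply: (char_poly_pencil_ge (posdef_first_form SigmaX Ac cz) (u0 pm) _ cpoly).
    move=> v; have omin p : mink o (X pm) <= mink o (X p).
      by rewrite -lerN2; exact: VM.
    have [_] := mink_min_tangent SigmaX omin v Ac cz inv.
    set Hs := \matrix_(i, j) _.
    (* Nonnegativity of this form at the farthest point gives [kappa >= V / u]; the unit shift then
       turns the bound into [(V - u) / u]. *)
    have -> : Hs = u pm *: second_form c X N z - V pm *: first_form c X z.
      apply/matrixP => i' j'; rewrite !mxE.
      rewrite [in LHS]oE -inv -scaleNr.
      rewrite (mink_normal_plane_hessian SigmaX smoothN tN) // !mxE inv; ring.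
    rewrite /quad mulmxBr mulmxBl -!scalemxAr -!scalemxAl !mxE subr_ge0.
    by [].
  rewrite mulrBl mulfV ?gt_eqF // !mxE lerD2r; exact: kk.
have beta1 : beta <= 1.
  have l0 : 0 < (V pm - u pm) / u pm by rewrite divr_gt0.
  have : beta * (u pm / (V pm - u pm)) <= ((V pm - u pm) / u pm)^-1.
    rewrite -VE -uE -eqn VE uE -[leRHS]mul1r -[X in _ <= X * _](a_sum pm) mulr_suml.
    apply: ler_sum => i _.
    rewrite mulr_suml; apply: ler_sum => j ijk; apply: ler_wpM2l.
      by case/andP: ijk => /a_ge0 ->.
    exact: Garding_quotient_le l0 kge kn (cone pm) ijk.
  by rewrite invf_div ger_pMl // divr_gt0.
have uH p : V p - u p <= u p * H1 p.
  have := lower p; rewrite mulrA ler_pdivlMr // mulrC ler_pdivrMr // => h.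
  apply: le_trans h _; rewrite ler_pM2r // ler_piMl //; exact: ltW.
have M0 : [set: M] !=set0 by exists pm.
have Vconst p p' : mink o (X p) = mink o (X p').
  apply: oppr_inj; rewrite -!minkNl.
  (* Applied to [- o], whose product with [X] is [V]. The trace of the shape operator is [n] times
     [H1 + 1], the [1] undoing the shift. *)
  apply: (mink_constant_of_superharmonic SigmaX nN smoothN tN M0) => d w Ad dw.
  set p1 := chart_inv d w.
  rewrite (mxtrace_char_poly n_ge1 (curvK d w Ad dw)) -/p1 !minkNl -/(V p1) -/(u p1).
  have n0 : 0 < n%:R :> R by rewrite ltr0n.
  have -> : \sum_i kappa p1 0 i = n%:R * (H1 p1 + 1).
    rewrite /H1 normalized_sigma1 mulrDr mulr1 mulrC divfK ?gt_eqF //.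
    under [in RHS]eq_bigr do rewrite !mxE.
    by rewrite sumrB sumr_const card_ord subrK.
  have -> : n%:R * V p1 - u p1 * (n%:R * (H1 p1 + 1)) =
    n%:R * ((V p1 - u p1) - u p1 * H1 p1) by ring.
  by rewrite pmulr_rle0 // subr_le0.
have Xm p : mink o (X p) = - V pm by rewrite opprK; exact: Vconst.
(* In the frame at [pm], [mink o o = -1] reads [V ^+ 2 - u ^+ 2 = 1], and [u > 0]; hence the radius
   is positive. *)
have V1 : 1 < V pm.
  have : mink o o = -1 by case: o_hyp.
  have [XX _] := hX pm; have [NX NN] := nN pm.
  rewrite {1 2}oE !minkE XX NN (minkC (X pm)) NX => e.
  have := u0 pm; have := uV pm; nra.
exists o, (arcosh (V pm)); split => //; first exact: arcosh_gt0.
apply/seteqP; split => [_ [p _ <-]|y [hy dy]].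
  by split => //; rewrite /hdist Xm opprK.
apply: (level_set_sub_range SigmaX nN tN n_ge1 M0 o_hyp Xm) => //.
  by move=> p; rewrite -oppr_eq0 gt_eqF //; exact: u0.
by rewrite -[LHS]opprK -cosh_hdist // dy cosh_arcosh // ltW.
Qed.
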